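(* Let $P_0$ be a convex centrally symmetric octagon which is not Poncelet but which is circumscribed about an ellipse, and let $P_k=T_3^k(P_0)$. Then $P_k$ converges to a convex Poncelet octagon as $k\to\infty$, and (if the iterates are all defined) $P_k$ converges to a star-convex Poncelet octagon as $k\to-\infty$. Up to affine transformation, the two limits have the same vertex set, and their vertex orders are related by the star-reordering $12345678\to 14725836$.
   Context: An octagon is a list of vertices $v_0,\dots,v_7$ in the plane (or projective plane), indices mod $8$. The $3$-diagonal map $T_3$ sends it to the octagon with vertices $v_k'=\overline{v_{k+1}v_{k+4}}\cap\overline{v_{k+2}v_{k+5}}$. It is generically defined and invertible; the inverse sends $w_0,\dots,w_7$ to the octagon with vertices $v_j=\overline{w_{j-2}w_{j-1}}\cap\overline{w_{j-5}w_{j-4}}$. An octagon is centrally symmetric if it is invariant under $p\mapsto -p$ (with $v_{k+4}=-v_k$). It is circumscribed about an ellipse (or conic) if all lines extending its edges are tangent to it, and inscribed in a conic if all its vertices lie on it. A Poncelet polygon is inscribed in one conic section and circumscribed about another. Convex means strictly convex, with vertices listed in cyclic order. The star-reordering of an octagon with vertices labelled $1,2,3,4,5,6,7,8$ in order is the octagon with the same vertices visited in the order $1,4,7,2,5,8,3,6$. An octagon is star-convex if its star-reordering is convex. Convergence is convergence in the space of affine equivalence classes of centrally symmetric octagons, up to cyclic/dihedral relabeling of the vertices: $P_k\to Q$ means that there are affine transformations $\alpha_k$ and dihedral relabelings $\rho_k$ of the vertices such that the vertices of $\rho_k(\alpha_k(P_k))$ converge to those of $Q$. *)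

(* Defs.v *)
From HB Require Import structures.
From mathcomp Require Import all_boot all_order all_algebra.
From mathcomp Require Import ring.
From mathcomp Require Import all_classical all_reals all_analysis.
Set Implicit Arguments.
Unset Strict Implicit.
Unset Printing Implicit Defensive.
Import Order.TTheory GRing.Theory Num.Theory.
Import numFieldNormedType.Exports.
Local Open Scope classical_set_scope.
Local Open Scope ring_scope.

Section Octagons.
Variable R : realType.

Definition octagon := 'Z_8 -> 'rV[R]_2.

Definition cross (u w : 'rV[R]_2) : R := u 0 0 * w 0 1 - u 0 1 * w 0 0.

Definition on_line (a b x : 'rV[R]_2) : Prop := exists t : R, x = a + t *: (b - a).

(* The lines ab and cd are well defined and not parallel. *)
Definition meet_defined (a b c d : 'rV[R]_2) : Prop := cross (b - a) (d - c) != 0.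

(* The intersection point of the lines ab and cd, when [meet_defined];
   see [meetP]. *)
Definition meet (a b c d : 'rV[R]_2) : 'rV[R]_2 :=
  a + (cross (c - a) (d - c) / cross (b - a) (d - c)) *: (b - a).

Lemma meetP (a b c d x : 'rV[R]_2) : meet_defined a b c d ->
  (on_line a b x /\ on_line c d x) <-> x = meet a b c d.
Proof.
rewrite /meet_defined => h; split.
  case=> [[t ->] [u e]].
  have e0 := congr1 (fun v : 'rV[R]_2 => v 0 0) e.
  have e1 := congr1 (fun v : 'rV[R]_2 => v 0 1) e.
  rewrite /meet; congr (a + _ *: _).
  apply: (mulIf h); rewrite divfK // /cross.
  rewrite !mxE in e0 e1 *.
  have sub_eq (p q r s : R) : p + q = r + s -> r - p = q - s.
    by move=> pq; rewrite -[r](addrK s) -pq; ring.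
  by rewrite (sub_eq _ _ _ _ e0) (sub_eq _ _ _ _ e1); ring.
move=> ->; split; first by exists (cross (c - a) (d - c) / cross (b - a) (d - c)).
exists (cross (c - a) (b - a) / cross (b - a) (d - c)).
move: h; rewrite /meet /cross !mxE => h.
by apply/rowP => i; rewrite !mxE; have [->|->] : i = 0 \/ i = 1;
  [case: i => [[|[|//]]] ?; [left|right]; exact/val_inj | field | field].
Qed.

(* [T3 P] is the image of P when [T3_defined P], and likewise for [T3inv]. *)
Definition T3_defined (P : octagon) : Prop :=
  forall k, meet_defined (P (k + 1)) (P (k + 4)) (P (k + 2)) (P (k + 5)).

Definition T3 (P : octagon) : octagon :=
  fun k => meet (P (k + 1)) (P (k + 4)) (P (k + 2)) (P (k + 5)).

Definition T3inv_defined (P : octagon) : Prop :=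
  forall j, meet_defined (P (j - 2)) (P (j - 1)) (P (j - 5)) (P (j - 4)).

Definition T3inv (P : octagon) : octagon :=
  fun j => meet (P (j - 2)) (P (j - 1)) (P (j - 5)) (P (j - 4)).

Definition centrally_symmetric (P : octagon) : Prop :=
  forall k, P (k + 4) = - P k.

(* All the other vertices lie strictly on the left of every oriented edge,
   or all of them strictly on the right. *)
Definition convex (P : octagon) : Prop :=
  (forall i j, j != i -> j != i + 1 ->
     0 < cross (P (i + 1) - P i) (P j - P i)) \/
  (forall i j, j != i -> j != i + 1 ->
     cross (P (i + 1) - P i) (P j - P i) < 0).

(* Vertices numbered from 0: the order is 0,3,6,1,4,7,2,5. *)
Definition star (P : octagon) : octagon := fun i => P (3 * i).

Definition star_convex (P : octagon) : Prop := convex (star P).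

(* Points of the projective plane are nonzero row vectors up to scaling;
   (x, y) in the plane is [x : y : 1], and the line at infinity is
   the set of the points [x : y : 0]. *)
Definition homog (p : 'rV[R]_2) : 'rV[R]_3 := row_mx p (1 : 'rV[R]_1).

Definition at_infinity (d : 'rV[R]_2) : 'rV[R]_3 := row_mx d (0 : 'rV[R]_1).

Definition on_conic (C : 'M[R]_3) (x : 'rV[R]_3) : Prop := x *m C *m x^T = 0.

(* A nondegenerate real conic with at least one real point. *)
Definition is_conic (C : 'M[R]_3) : Prop :=
  [/\ C^T = C, C \in unitmx & exists2 x, x != 0 & on_conic C x].

(* An ellipse is a conic that does not meet the line at infinity. *)
Definition is_ellipse (C : 'M[R]_3) : Prop :=
  is_conic C /\ forall d, d != 0 -> ~ on_conic C (at_infinity d).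

(* The projective line x *m C *m y^T = 0 (in the unknown y) is the tangent line
   of C at its point x. *)
Definition on_tangent_at (C : 'M[R]_3) (x y : 'rV[R]_3) : Prop :=
  x *m C *m y^T = 0.

Definition line_tangent (C : 'M[R]_3) (a b : 'rV[R]_2) : Prop :=
  a != b /\
  exists x : 'rV[R]_3, [/\ x != 0, on_conic C x,
    on_tangent_at C x (homog a) & on_tangent_at C x (homog b)].

Definition inscribed (P : octagon) (C : 'M[R]_3) : Prop :=
  forall k, on_conic C (homog (P k)).

Definition circumscribed (P : octagon) (C : 'M[R]_3) : Prop :=
  forall k, line_tangent C (P k) (P (k + 1)).

(* Proportional matrices define the same conic. *)
Definition Poncelet (P : octagon) : Prop :=
  exists C D : 'M[R]_3, [/\ is_conic C, is_conic D,
    ~ (exists c : R, D = c *: C), inscribed P C & circumscribed P D].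

Definition affine_map (A : 'M[R]_2) (b p : 'rV[R]_2) : 'rV[R]_2 := p *m A + b.

Definition dihedral (s : 'Z_8 -> 'Z_8) : Prop :=
  exists c, (forall i, s i = c + i) \/ (forall i, s i = c - i).

Definition octagon_cvg (P : nat -> octagon) (Q : octagon) : Prop :=
  exists (A : nat -> 'M[R]_2) (b : nat -> 'rV[R]_2) (s : nat -> 'Z_8 -> 'Z_8),
    [/\ forall k, A k \in unitmx, forall k, dihedral (s k) &
        forall i, (fun k => affine_map (A k) (b k) (P k (s k i))) @ \oo --> Q i].

(* Some affine image of Q has the same vertices as P, visited in the
   star-reordered order up to a dihedral relabeling. *)
Definition star_related (P Q : octagon) : Prop :=
  exists (A : 'M[R]_2) (b : 'rV[R]_2), [/\ A \in unitmx,
    range (fun i => affine_map A b (Q i)) = range P &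
    exists2 s, dihedral s & forall i, affine_map A b (Q (s i)) = star P i].

End Octagons.

(* Main.v *)
Require Import Defs.
From mathcomp Require Import all_boot all_order all_algebra.
From mathcomp Require Import ring lra.
From mathcomp Require Import all_classical all_reals all_analysis.
Set Implicit Arguments.
Unset Strict Implicit.
Unset Printing Implicit Defensive.
Import Order.TTheory GRing.Theory Num.Theory.
Import numFieldNormedType.Exports.
Local Open Scope classical_set_scope.
Local Open Scope ring_scope.

(** The proof finds coordinates on centrally symmetric circumscribed octagons
    in which [T3] is a contraction [z -> - rate * z].

    Up to linear maps and a common scale, a centrally symmetric octagon is
    given by the determinants a_k of consecutive vertices ([side]) and b_k of
    vertices two apart ([chord]), with a_k and b_k of periods 4 and 2 and the
    single Pluecker relation a0 a2 + a1 a3 = b0 b1.  If the octagon is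
    circumscribed about an ellipse, parallelism of opposite edges puts the
    centre of the ellipse at the origin ([ellipse_qform]).  In the metric that
    turns the ellipse into a circle, a_k is, up to a common sign and scale, the
    length of the k-th edge, and equality of the two tangent segments at each
    vertex gives a0 + a2 = a1 + a3 ([pitot]).  This linear relation is used to
    write the sides as s + al x + be y, s - al x + be y, s - al x - be y,
    s + al x - be y and the chords as 2x, 2y ([has_coords]); the Pluecker
    relation becomes s^2 = al^2 x^2 + be^2 y^2 + 2xy.

    In these coordinates [T3], followed by a shift of the labels by one, fixes
    al and be and acts on (s : x : y) by a linear map ([T3_coords]).  Thus every
    octagon moves along a conic, on which [T3] is a projective transformation
    with two fixed points.  Parametrising the conic rationally with the fixed
    points at z = 0 and z = oo, [T3] becomes z -> - rate * z with
    0 <= rate < 1 ([next_chart]).  Forward orbits therefore converge to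
    the octagon at z = 0.  That octagon is convex, it is inscribed in a conic
    ([normal_inscribed]) and circumscribed about another one
    ([normal_circumscribed]), hence Poncelet.  For a convex octagon s, x and y
    have the same sign; the linear map has positive coefficients, so this
    persists along the orbit and keeps all the denominators nonzero.

    Visiting the vertices in the order k -> 5k + c, which is the star-reordering
    up to reversal, conjugates [T3] to its inverse ([T3_skew]) because it
    exchanges edges and 3-diagonals; with c = 2 it fixes al and be
    and sends z to 1/z ([skew_chart]).  An octagon that is not Poncelet has
    z != 0, so its backward orbit is, up to this reordering, a forward orbit of
    the same kind.  It converges to the same octagon z = 0, read in the star
    order. *)

(** * Determinants of plane vectors *)

Section Cross.
Variable R : realType.
Implicit Types (a b c d x : 'rV[R]_2) (P : octagon R).

Lemma crossC a b : cross a b = - cross b a.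
Proof. by rewrite /cross; ring. Qed.

Lemma crossNr a b : cross a (- b) = - cross a b.
Proof. by rewrite /cross !mxE; ring. Qed.

Lemma crossNl a b : cross (- a) b = - cross a b.
Proof. by rewrite /cross !mxE; ring. Qed.

Lemma cross_plucker a b c d :
  cross a b * cross c d + cross a d * cross b c = cross a c * cross b d.
Proof. by rewrite /cross; ring. Qed.

Lemma cross_comb (w x y z p q : R) a b c d : cross
  (p *: (w *: a - x *: b)) (q *: (y *: c - z *: d)) =
  p * q * (w * y * cross a c - w * z * cross a d
           - x * y * cross b c + x * z * cross b d).
Proof. by rewrite /cross !mxE; ring. Qed.

Lemma row2P a b : a 0 0 = b 0 0 -> a 0 1 = b 0 1 -> a = b.
Proof.
move=> e0 e1; apply/rowP => i.
have [->|->//] : i = 0 \/ i = 1.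
  by case: i => [[|[|//]]] ?; [left|right]; exact/val_inj.
exact: e0.
Qed.

Lemma Z8_ind (Q : 'Z_8 -> Prop) :
  Q 0 -> Q 1 -> Q 2 -> Q 3 -> Q 4 -> Q 5 -> Q 6 -> Q 7 -> forall i, Q i.
Proof.
move=> q0 q1 q2 q3 q4 q5 q6 q7 [[|[|[|[|[|[|[|[|//]]]]]]]] lt].
- by rewrite (_ : Ordinal lt = 0) //; apply/val_inj.
- by rewrite (_ : Ordinal lt = 1) //; apply/val_inj.
- by rewrite (_ : Ordinal lt = 2) //; apply/val_inj.
- by rewrite (_ : Ordinal lt = 3) //; apply/val_inj.
- by rewrite (_ : Ordinal lt = 4) //; apply/val_inj.
- by rewrite (_ : Ordinal lt = 5) //; apply/val_inj.
- by rewrite (_ : Ordinal lt = 6) //; apply/val_inj.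
- by rewrite (_ : Ordinal lt = 7) //; apply/val_inj.
Qed.

End Cross.

(** * The 3-diagonal map in terms of sides and chords *)

Section T3Brackets.
Variable R : realType.
Implicit Type P : octagon R.

Definition side P k := cross (P k) (P (k + 1)).
Definition chord P k := cross (P k) (P (k + 2)).

Definition T3den P k := side P k + side P (k + 1) + chord P k.

Variable P : octagon R.
Hypothesis cs : centrally_symmetric P.

Local Notation a := (side P).
Local Notation b := (chord P).
Local Notation F := (T3den P).

Lemma T3_denE k :
  cross (P (k + 4) - P (k + 1)) (P (k + 5) - P (k + 2)) = F k.
Proof.
rewrite (_ : k + 5 = k + 1 + 4); last by ring.
rewrite !cs /T3den /side /chord (_ : k + 1 + 1 = k + 2); last by ring.
by rewrite /cross !mxE; ring.
Qed.

Lemma T3_definedE : T3_defined P <-> forall k, F k != 0.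
Proof. by split=> h k; [rewrite -T3_denE|rewrite /meet_defined T3_denE]; exact: h. Qed.

(** Since [P (k + 4) = - P k] and [P (k + 5) = - P (k + 1)], the two diagonals
    that meet in [T3 P k] only involve [P k], [P (k + 1)] and [P (k + 2)]. *)
Lemma T3E k : F k != 0 ->
  T3 P k = (F k)^-1 *:
    ((a k - a (k + 1) + b k) *: P (k + 1) - (2 * a (k + 1)) *: P k).
Proof.
move=> Fk0; rewrite /T3 /meet T3_denE.
have -> : cross (P (k + 2) - P (k + 1)) (P (k + 5) - P (k + 2)) =
          2 * a (k + 1).
  rewrite (_ : k + 5 = k + 1 + 4); last by ring.
  rewrite !cs /side (_ : k + 1 + 1 = k + 2); last by ring.
  by rewrite /cross !mxE; ring.
rewrite cs; move: Fk0; rewrite /T3den => Fk0.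
by apply: row2P; rewrite !mxE; field.
Qed.

Lemma T3_side k : F k != 0 -> F (k + 1) != 0 ->
  cross (T3 P k) (T3 P (k + 1)) =
  a (k + 1) * ((a k - a (k + 1) + b k) * (a (k + 1) - a (k + 2) + b (k + 1))
    - 2 * b k * (a (k + 1) - a (k + 2) + b (k + 1))
    + 4 * a k * a (k + 2)) / (F k * F (k + 1)).
Proof.
move=> F0 F1; rewrite !T3E // cross_comb.
rewrite (_ : k + 1 + 1 = k + 2); last by ring.
rewrite -/(a k) -/(b k).
have -> : cross (P (k + 1)) (P (k + 2)) = a (k + 1).
  by rewrite /side (_ : k + 1 + 1 = k + 2) //; ring.
have -> : cross (P (k + 1)) (P (k + 1)) = 0 by rewrite /cross; ring.
by field; rewrite F0 F1.
Qed.

Lemma T3_diagonal k : F k != 0 -> F (k + 2) != 0 ->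
  cross (T3 P k) (T3 P (k + 2)) =
  ((a k - a (k + 1) + b k) * (a (k + 2) - a (k + 3) + b (k + 2)) * b (k + 1)
   - 2 * a (k + 1) * a (k + 3) * ((a k - a (k + 1) + b k)
      + (a (k + 2) - a (k + 3) + b (k + 2)) - 2 * b k)) / (F k * F (k + 2)).
Proof.
move=> F0 F1; rewrite !T3E // cross_comb.
rewrite (_ : k + 2 + 1 = k + 3); last by ring.
rewrite -/(a k) -/(b k).
have -> : cross (P (k + 1)) (P (k + 2)) = a (k + 1).
  by rewrite /side (_ : k + 1 + 1 = k + 2) //; ring.
have -> : cross (P (k + 1)) (P (k + 3)) = b (k + 1).
  by rewrite /chord (_ : k + 1 + 2 = k + 3) //; ring.
have -> : cross (P k) (P (k + 3)) = a (k + 3).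
  rewrite /side (_ : k + 3 + 1 = k + 4); last by ring.
  by rewrite cs crossNr -crossC.
by field; rewrite F0 F1.
Qed.

End T3Brackets.

(** * Coordinates in which the 3-diagonal map is linear *)

Section Coordinates.
Variable R : realType.
Implicit Types (P : octagon R) (al be s x y : R).

(** The Pluecker relation, in the coordinates of [has_coords]. *)
Definition conic_eq al be s x y : Prop :=
  s ^+ 2 = al ^+ 2 * x ^+ 2 + be ^+ 2 * y ^+ 2 + 2 * x * y.

(** The four sides are free up to a0 + a2 = a1 + a3.  The differences a0 - a1
    and a0 - a3 are measured in units of the chords because the ratios
    [al] = (a0 - a1) / b0 and [be] = (a0 - a3) / b1 are invariants of [T3]. *)
Definition has_coords P al be s x y : Prop :=
  [/\ [/\ cross (P 0) (P 1) = s + al * x + be * y,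
          cross (P 1) (P 2) = s - al * x + be * y,
          cross (P 2) (P 3) = s - al * x - be * y &
          cross (P 3) (P 4) = s + al * x - be * y],
      cross (P 0) (P 2) = 2 * x & cross (P 1) (P 3) = 2 * y].

Lemma coords_conic P al be s x y : centrally_symmetric P ->
  has_coords P al be s x y -> conic_eq al be s x y.
Proof.
move=> cs [[e0 e1 e2 e3] f0 f1].
have := cross_plucker (P 0) (P 1) (P 2) (P 3).
have e3' : cross (P 0) (P 3) = s + al * x - be * y.
  by rewrite -e3 (_ : (4 : 'Z_8) = 0 + 4) ?cs 1?crossNr -?crossC //; ring.
by rewrite e0 e1 e2 e3' f0 f1 /conic_eq => e; lra.
Qed.

(** The linear map of the (s, x, y) space that [T3] induces, in the
    normalisation where its coefficients are polynomials. *)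
Definition nextx al be s x y : R := (1 - be ^+ 2) * ((1 + al ^+ 2) * x + 2 * y + 2 * s).
Definition nexty al be s x y : R := (1 - al ^+ 2) * ((1 + be ^+ 2) * y + 2 * x + 2 * s).
Definition nexts al be s x y : R :=
  2 * (1 - al ^+ 2 * be ^+ 2) * (x + y) +
  (3 - al ^+ 2 - be ^+ 2 - al ^+ 2 * be ^+ 2) * s.

(** The left-hand side is, up to a factor 4, a product of two opposite
    denominators of [T3]; the factor [x] appears because each of these two
    lines meets the conic at a point with x = 0. *)
Lemma diag_prod al be s x y : conic_eq al be s x y ->
  (s + x + be * y) * (s + x - be * y) = x * ((1 + al ^+ 2) * x + 2 * y + 2 * s).
Proof. by rewrite /conic_eq => h; ring: h. Qed.

(** The reason for the linearity of [T3]: a side of the new octagon is a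
    quotient of two polynomials of degree three and two, but modulo the conic it
    is a linear form times a factor that is the same for all sides and chords.
    The other three sides follow by changing the signs of [al] and [be]. *)
Lemma side_prod al be s x y : conic_eq al be s x y ->
  (s - al * x - be * y) * (1 + al) * (1 + be)
    * (s + be * y + x) * (s + al * x + y) =
  x * y * (nexts al be s x y + al * nextx al be s x y + be * nexty al be s x y).
Proof. by rewrite /conic_eq /nexts /nextx /nexty => h; ring: h. Qed.

End Coordinates.

Section Step.
Variables (R : realType) (P : octagon R) (al be s x y : R).
Hypotheses (cs : centrally_symmetric P) (hc : has_coords P al be s x y).

Local Notation a := (side P).
Local Notation b := (chord P).
Local Notation F := (T3den P).

Lemma cross_cs (i j : 'Z_8) : cross (P (i + 4)) (P (j + 4)) = cross (P i) (P j).
Proof. by rewrite !cs crossNl crossNr opprK. Qed.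

Lemma side_coords : [/\ a 0 = s + al * x + be * y, a 1 = s - al * x + be * y,
  a 2 = s - al * x - be * y & a 3 = s + al * x - be * y].
Proof.
case: hc => [[e0 e1 e2 e3] _ _]; rewrite /side.
by split; [rewrite -e0|rewrite -e1|rewrite -e2|rewrite -e3]; congr cross;
  congr P; exact/val_inj.
Qed.

Lemma side_add4 k : a (k + 4) = a k.
Proof. by rewrite /side addrAC cross_cs. Qed.

Lemma chord_add2 k : b (k + 2) = b k.
Proof.
by rewrite /chord -addrA (_ : 2 + 2 = 4 :> 'Z_8) ?cs ?crossNr -?crossC //; exact/val_inj.
Qed.

Lemma chord_coords : [/\ b 0 = 2 * x, b 1 = 2 * y, b 2 = 2 * x & b 3 = 2 * y].
Proof.
have [_ f0 f1] := hc.
have b0 : b 0 = 2 * x by rewrite /chord -f0 add0r.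
have b1 : b 1 = 2 * y.
  by rewrite /chord -f1; congr (cross _ (P _)); exact/val_inj.
split=> //; first by rewrite -b0 -(chord_add2 0) add0r.
by rewrite -b1 -(chord_add2 1); congr chord; exact/val_inj.
Qed.

Lemma T3den_add4 k : F (k + 4) = F k.
Proof.
rewrite /T3den side_add4 (addrAC k 4 1) side_add4; congr (_ + _).
by rewrite (_ : k + 4 = k + 2 + 2) ?chord_add2 //; ring.
Qed.

Lemma T3den_coords : [/\ F 0 = 2 * (s + x + be * y), F 1 = 2 * (s + y - al * x),
  F 2 = 2 * (s + x - be * y) & F 3 = 2 * (s + y + al * x)].
Proof.
have [e0 e1 e2 e3] := side_coords; have [f0 f1 b2E b3E] := chord_coords.
rewrite /T3den.
have a31 : a (3 + 1) = s + al * x + be * y.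
  by rewrite -e0 -(side_add4 0); congr side; exact/val_inj.
have a01 : a (0 + 1) = s - al * x + be * y.
  by rewrite -e1; congr side; exact/val_inj.
have a11 : a (1 + 1) = s - al * x - be * y.
  by rewrite -e2; congr side; exact/val_inj.
have a21 : a (2 + 1) = s + al * x - be * y.
  by rewrite -e3; congr side; exact/val_inj.
split.
- by rewrite a01 e0 f0; ring.
- by rewrite a11 e1 f1; ring.
- by rewrite a21 e2 b2E; ring.
- by rewrite a31 e3 b3E; ring.
Qed.

Lemma T3_defined_coords : T3_defined P <->
  [/\ s + x + be * y != 0, s + y - al * x != 0,
      s + x - be * y != 0 & s + y + al * x != 0].
Proof.
have n2 : (2 : R) != 0 by rewrite pnatr_eq0.
rewrite T3_definedE //; split=> [h|[]].
  case: T3den_coords => e0 e1 e2 e3.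
  split; apply/eqP => e; [move: (h 0)|move: (h 1)|move: (h 2)|move: (h 3)].
  - by rewrite e0 e mulr0 eqxx.
  - by rewrite e1 e mulr0 eqxx.
  - by rewrite e2 e mulr0 eqxx.
  - by rewrite e3 e mulr0 eqxx.
move=> n0 n1 n2' n3; case: T3den_coords => e0 e1 e2 e3.
have h k : F k != 0 -> F (k + 4) != 0 by rewrite T3den_add4.
have h0 : F 0 != 0 by rewrite e0 mulf_neq0.
have h1 : F 1 != 0 by rewrite e1 mulf_neq0.
have h2 : F 2 != 0 by rewrite e2 mulf_neq0.
have h3 : F 3 != 0 by rewrite e3 mulf_neq0.
apply: Z8_ind => //.
- by rewrite (_ : (4 : 'Z_8) = 0 + 4) ?T3den_add4 //; exact/val_inj.
- by rewrite (_ : (5 : 'Z_8) = 1 + 4) ?T3den_add4 //; exact/val_inj.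
- by rewrite (_ : (6 : 'Z_8) = 2 + 4) ?T3den_add4 //; exact/val_inj.
- by rewrite (_ : (7 : 'Z_8) = 3 + 4) ?T3den_add4 //; exact/val_inj.
Qed.

(** One side and one chord of the image are enough: the other ones are
    instances of these for the octagon with shifted labels. *)
Lemma T3_first_coords : T3_defined P ->
  let c := (x * y) ^+ 2 / ((s + x + be * y) * (s + x - be * y)
                           * ((s + y - al * x) * (s + y + al * x))) in
  cross (T3 P 0) (T3 P 1) = c * (nexts al be s x y
    + al * nextx al be s x y - be * nexty al be s x y) /\
  cross (T3 P 0) (T3 P 2) = 2 * (c * nexty al be s x y).
Proof.
move=> Pdef /=.
have Q : conic_eq al be s x y by exact: coords_conic hc.
have [n0 n1 n2 n3] := T3_defined_coords.1 Pdef.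
have Fn0 := (T3_definedE cs).1 Pdef.
have [e0 e1 e2 e3] := side_coords.
have [f0 f1 b2E _] := chord_coords.
have [F0E F1E F2E _] := T3den_coords.
(* [q * r] is the product evaluated by [side_prod] or [diag_prod]. *)
have ratio (q W p r : R) : q * r = x * y * W -> p * r != 0 ->
    x * y * q / p = (x * y) ^+ 2 / (p * r) * W.
  rewrite mulf_eq0 negb_or => h /andP[d0 r0].
  have -> : (x * y) ^+ 2 / (p * r) * W = x * y * (q * r) / (p * r).
    by rewrite h; ring.
  by field; rewrite d0 r0.
split.
- have -> : T3 P 1 = T3 P (0 + 1) by rewrite add0r.
  rewrite T3_side ?Fn0 // !add0r e0 e1 e2 f0 f1 F0E F1E.
  transitivity (x * y * ((s - al * x + be * y) * (1 + al) * (1 - be)) /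
    ((s + x + be * y) * (s + y - al * x))).
    by field: Q; rewrite n1 n0.
  have -> : (s + x + be * y) * (s + x - be * y)
              * ((s + y - al * x) * (s + y + al * x)) =
            (s + x + be * y) * (s + y - al * x)
              * ((s + x - be * y) * (s + y + al * x)) by ring.
  apply: ratio; last by rewrite !mulf_neq0.
  have Q' : conic_eq al (- be) s x y by rewrite /conic_eq sqrrN.
  have := side_prod Q'; rewrite /nexts /nextx /nexty !sqrrN => h.
  transitivity ((s - al * x - - be * y) * (1 + al) * (1 + - be)
    * (s + - be * y + x) * (s + al * x + y)); first by ring.
  by rewrite h; ring.
- have -> : T3 P 2 = T3 P (0 + 2) by rewrite add0r.
  rewrite T3_diagonal ?Fn0 // !add0r e0 e1 e2 e3 f0 f1 b2E F0E F2E.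
  transitivity (2 * (x * y * ((1 - al ^+ 2) * x) /
    ((s + x + be * y) * (s + x - be * y)))).
    by field; rewrite n2 n0.
  congr (2 * _); apply: ratio; last by rewrite !mulf_neq0.
  have Q' : conic_eq be al s y x by rewrite /conic_eq Q; ring.
  have -> : (s + y - al * x) * (s + y + al * x) =
            (s + y + al * x) * (s + y - al * x) by ring.
  by rewrite -mulrA (diag_prod Q') /nexty; ring.
Qed.

End Step.

Section StepCoordinates.
Variable R : realType.
Implicit Types (P : octagon R) (al be s x y : R).

Definition turn P : octagon R := fun i => P (i + 1).

Lemma cs_turn P : centrally_symmetric P -> centrally_symmetric (turn P).
Proof. by move=> cs k; rewrite /turn addrAC cs. Qed.

(** A shift of the labels exchanges the two chords and rotates the pair
    ([al], [be]) by a quarter turn. *)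
Lemma turn_coords P al be s x y : centrally_symmetric P ->
  has_coords P al be s x y -> has_coords (turn P) be (- al) s y x.
Proof.
move=> cs hc; case: (hc) => [[e0 e1 e2 e3] f0 f1].
have p4 : P 4 = - P 0 by rewrite -(cs 0); congr P; exact/val_inj.
have p5 : P 5 = - P 1 by rewrite -(cs 1); congr P; exact/val_inj.
have t0 : turn P 0 = P 1 by congr P; exact/val_inj.
have t1 : turn P 1 = P 2 by congr P; exact/val_inj.
have t2 : turn P 2 = P 3 by congr P; exact/val_inj.
have t3 : turn P 3 = P 4 by congr P; exact/val_inj.
have t4 : turn P 4 = P 5 by congr P; exact/val_inj.
rewrite /has_coords t0 t1 t2 t3 t4 e1 e2 e3 f1 p4 p5 crossNl crossNr opprK e0.
by rewrite crossNr -crossC f0; split=> //; first split; ring.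
Qed.

Lemma T3_turn P k : T3 (turn P) k = T3 P (k + 1).
Proof. by rewrite /T3 /turn -!(addrAC _ 1). Qed.

Lemma T3_defined_turn P : T3_defined P -> T3_defined (turn P).
Proof. by move=> h k; rewrite /turn -!(addrAC _ 1); exact: h. Qed.

Definition next_scale al be s x y : R :=
  (x * y) ^+ 2 / ((s + x + be * y) * (s + x - be * y)
                  * ((s + y - al * x) * (s + y + al * x))).

(** The image is read with a shift of the labels by one: [T3] moves vertex k of a
    regular octagon to the direction of vertex k + 3, so that after the shift
    every vertex goes to a negative multiple of itself. *)
Lemma T3_coords P al be s x y : centrally_symmetric P ->
  has_coords P al be s x y -> T3_defined P ->
  let c := next_scale al be s x y in
  has_coords (turn (T3 P)) al be
    (c * nexts al be s x y) (c * nextx al be s x y) (c * nexty al be s x y).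
Proof.
move=> cs0 h0 d0 c.
have [cs1 h1 d1] : [/\ centrally_symmetric (turn P),
  has_coords (turn P) be (- al) s y x & T3_defined (turn P)].
  by split; [exact: cs_turn|exact: turn_coords|exact: T3_defined_turn].
have [cs2 h2 d2] : [/\ centrally_symmetric (turn (turn P)),
  has_coords (turn (turn P)) (- al) (- be) s x y & T3_defined (turn (turn P))].
  by split; [exact: cs_turn|exact: turn_coords|exact: T3_defined_turn].
have [cs3 h3 d3] : [/\ centrally_symmetric (turn (turn (turn P))),
  has_coords (turn (turn (turn P))) (- be) (- - al) s y x
  & T3_defined (turn (turn (turn P)))].
  by split; [exact: cs_turn|exact: turn_coords|exact: T3_defined_turn].
have [cs4 h4 d4] : [/\ centrally_symmetric (turn (turn (turn (turn P)))),
  has_coords (turn (turn (turn (turn P)))) (- - al) (- - be) s x y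
  & T3_defined (turn (turn (turn (turn P))))].
  by split; [exact: cs_turn|exact: turn_coords|exact: T3_defined_turn].
have [a1 b1] := T3_first_coords cs1 h1 d1.
have [a2 b2] := T3_first_coords cs2 h2 d2.
have [a3 _] := T3_first_coords cs3 h3 d3.
have [a4 _] := T3_first_coords cs4 h4 d4.
rewrite !T3_turn in a1 b1 a2 b2 a3 a4.
rewrite /has_coords /turn.
have i1 : (1 + 1 + 1 : 'Z_8) = 2 + 1 by exact/val_inj.
have i2 : (0 + 1 + 1 : 'Z_8) = 1 + 1 by exact/val_inj.
have i3 : (1 + 1 + 1 + 1 : 'Z_8) = 3 + 1 by exact/val_inj.
have i4 : (2 + 1 + 1 : 'Z_8) = 3 + 1 by exact/val_inj.
have i5 : (0 + 1 + 1 + 1 : 'Z_8) = 2 + 1 by exact/val_inj.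
have i6 : (0 + 1 + 1 + 1 + 1 : 'Z_8) = 3 + 1 by exact/val_inj.
have i7 : (1 + 1 + 1 + 1 + 1 : 'Z_8) = 4 + 1 by exact/val_inj.
rewrite i1 i2 in a2; rewrite i2 i4 in b2; rewrite i3 i5 in a3.
rewrite i6 i7 in a4; rewrite a1 a2 a3 a4 b1 b2.
have key (m d w W : R) : m = (x * y) ^+ 2 ->
    d = (s + x + be * y) * (s + x - be * y)
          * ((s + y - al * x) * (s + y + al * x)) ->
    w = W -> m / d * w = c * W.
  by move=> -> -> ->.
split; first split.
- transitivity (c * (nexts al be s x y
    + al * nextx al be s x y + be * nexty al be s x y)); last by ring.
  by apply: key; rewrite /nexts /nextx /nexty; ring.
- transitivity (c * (nexts al be s x y
    - al * nextx al be s x y + be * nexty al be s x y)); last by ring.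
  by apply: key; rewrite /nexts /nextx /nexty; ring.
- transitivity (c * (nexts al be s x y
    - al * nextx al be s x y - be * nexty al be s x y)); last by ring.
  by apply: key; rewrite /nexts /nextx /nexty; ring.
- transitivity (c * (nexts al be s x y
    + al * nextx al be s x y - be * nexty al be s x y)); last by ring.
  by apply: key; rewrite /nexts /nextx /nexty; ring.
- by congr (2 * _); apply: key; rewrite /nextx /nexty; ring.
- by congr (2 * _); apply: key; rewrite /nextx /nexty; ring.
Qed.

End StepCoordinates.

(** * The rational parametrisation of the conic *)

Section Parametrisation.
Variables (R : realType) (al be : R).
Hypotheses (al1 : al ^+ 2 < 1) (be1 : be ^+ 2 < 1).

Definition rootU : R := Num.sqrt (2 - al ^+ 2 - be ^+ 2).
Definition rootV : R := Num.sqrt (1 - al ^+ 2 * be ^+ 2).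
Definition rate : R := (rootU - rootV) / (rootU + rootV).

(** With h = x + y and e = (1 - al^2) x - (1 - be^2) y, the conic is
    (v h + u s) (v h - u s) = e^2, where u = [rootU] and v = [rootV].  The
    parameter is z = e / (v h + u s), so that the linear map of [next_chart],
    which scales e and v h + u s by constants, scales z. *)
Definition chart_s z : R := rootU * rootV * (1 - z ^+ 2).
Definition chart_x z : R := (1 - be ^+ 2) * (1 + z ^+ 2) + 2 * rootV * z.
Definition chart_y z : R := (1 - al ^+ 2) * (1 + z ^+ 2) - 2 * rootV * z.

Definition in_chart (P : octagon R) t z : Prop :=
  has_coords P al be (t * chart_s z) (t * chart_x z) (t * chart_y z).

Local Notation u := rootU.
Local Notation v := rootV.

Lemma rootU_arg : 0 < 2 - al ^+ 2 - be ^+ 2.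
Proof. by move: (al ^+ 2) (be ^+ 2) al1 be1 => p q p1 q1; lra. Qed.

Lemma rootU2 : u ^+ 2 = 2 - al ^+ 2 - be ^+ 2.
Proof. by rewrite sqr_sqrtr // ltW // rootU_arg. Qed.

Lemma rootV_arg : 0 < 1 - al ^+ 2 * be ^+ 2.
Proof.
have : 0 < (1 - al ^+ 2) * (1 + be ^+ 2).
  by rewrite mulr_gt0 // ?subr_gt0 // ltr_wpDr // sqr_ge0.
have : 0 < (1 - be ^+ 2) * (1 + al ^+ 2).
  by rewrite mulr_gt0 // ?subr_gt0 // ltr_wpDr // sqr_ge0.
by move: (al ^+ 2) (be ^+ 2) => p q h1 h2; lra.
Qed.

Lemma rootV2 : v ^+ 2 = 1 - al ^+ 2 * be ^+ 2.
Proof. by rewrite sqr_sqrtr // ltW // rootV_arg. Qed.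

Lemma rootV_gt0 : 0 < v.
Proof. by rewrite sqrtr_gt0 rootV_arg. Qed.

Lemma rootV_lt_rootU : v < u.
Proof.
rewrite ltr_sqrt; last exact: rootU_arg.
have : 0 < (1 - al ^+ 2) * (1 - be ^+ 2) by rewrite mulr_gt0 // subr_gt0.
by move: (al ^+ 2) (be ^+ 2) => p q h; lra.
Qed.

Lemma rootU_gt0 : 0 < u.
Proof. exact: lt_trans rootV_gt0 rootV_lt_rootU. Qed.

Lemma rate_ge0 : 0 <= rate.
Proof.
by rewrite divr_ge0 // ?subr_ge0 ?ltW ?rootV_lt_rootU // addr_gt0 ?rootU_gt0 ?rootV_gt0.
Qed.

Lemma rate_lt1 : rate < 1.
Proof.
have u0 := rootU_gt0; have v0 := rootV_gt0.
by rewrite ltr_pdivrMr ?addr_gt0 // mul1r; lra.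
Qed.

Lemma chart_conic z : conic_eq al be (chart_s z) (chart_x z) (chart_y z).
Proof.
by rewrite /conic_eq /chart_s /chart_x /chart_y; ring: rootU2 rootV2.
Qed.

(** The only point of the conic that the parametrisation misses is z = oo,
    where v (x + y) + u s vanishes. *)
Lemma chart_surj s x y : conic_eq al be s x y -> v * (x + y) + u * s != 0 ->
  exists z, let t := (v * (x + y) + u * s) / (2 * u ^+ 2 * v) in
  [/\ s = t * chart_s z, x = t * chart_x z & y = t * chart_y z].
Proof.
move=> Q; set w := _ + _ => w0.
have u0 : u != 0 by rewrite gt_eqF ?rootU_gt0.
have v0 : v != 0 by rewrite gt_eqF ?rootV_gt0.
exists (((1 - al ^+ 2) * x - (1 - be ^+ 2) * y) / w).
set e := _ * x - _.
have e2 : e ^+ 2 = w * (v * (x + y) - u * s).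
  by rewrite /e /w; ring: Q rootU2 rootV2.
have U2 := rootU2.
split.
- have -> : s = (w - (v * (x + y) - u * s)) / (2 * u) by rewrite /w; field.
  have -> : v * (x + y) - u * s = e ^+ 2 / w by rewrite e2; field.
  by rewrite /chart_s; field; rewrite ?u0 ?v0 w0.
- have -> : x = ((1 - be ^+ 2) * (x + y) + e) / u ^+ 2.
    by rewrite /e; field: U2.
  have -> : x + y = (w + e ^+ 2 / w) / (2 * v) by rewrite e2 /w; field; rewrite v0.
  by rewrite /chart_x; field; rewrite ?u0 ?v0 w0.
- have -> : y = ((1 - al ^+ 2) * (x + y) - e) / u ^+ 2.
    by rewrite /e; field: U2.
  have -> : x + y = (w + e ^+ 2 / w) / (2 * v) by rewrite e2 /w; field; rewrite v0.
  by rewrite /chart_y; field; rewrite ?u0 ?v0 w0.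
Qed.

(** The linear map multiplies v h + u s by (u + v)^2 and e by v^2 - u^2; the
    second factor divided by the first one is - [rate]. *)
Lemma next_chart z : let m := (u + v) ^+ 2 in let z' := - rate * z in
  [/\ nexts al be (chart_s z) (chart_x z) (chart_y z) = m * chart_s z',
      nextx al be (chart_s z) (chart_x z) (chart_y z) = m * chart_x z' &
      nexty al be (chart_s z) (chart_x z) (chart_y z) = m * chart_y z'].
Proof.
have U2 := rootU2; have V2 := rootV2.
have uv0 : u + v != 0 by rewrite gt_eqF // addr_gt0 ?rootU_gt0 ?rootV_gt0.
split.
- by rewrite /nexts /chart_s /chart_x /chart_y /rate; field: U2 V2.
- by rewrite /nextx /chart_s /chart_x /chart_y /rate; field: U2 V2.
- by rewrite /nexty /chart_s /chart_x /chart_y /rate; field: U2 V2.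
Qed.

End Parametrisation.

(** * Orbits of the 3-diagonal map *)

Section Orbit.
Variables (R : realType) (al be : R).
Hypotheses (al1 : al ^+ 2 < 1) (be1 : be ^+ 2 < 1).
Implicit Types (P : octagon R) (t z : R).

Definition turn_by (j : 'Z_8) P : octagon R := fun i => P (i + j).

Lemma T3_turn_by j P k : T3 (turn_by j P) k = T3 P (k + j).
Proof. by rewrite /T3 /turn_by -!(addrAC _ j). Qed.

Lemma T3_defined_turn_by j P : T3_defined (turn_by j P) <-> T3_defined P.
Proof.
split=> h k; last by rewrite /turn_by -!(addrAC _ j); exact: h.
have e n : k - j + n + j = k + n by rewrite addrAC subrK.
by have := h (k - j); rewrite /turn_by !e.
Qed.

Lemma cs_turn_by j P : centrally_symmetric P -> centrally_symmetric (turn_by j P).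
Proof. by move=> cs k; rewrite /turn_by addrAC cs. Qed.

Lemma cs_T3 P : centrally_symmetric P -> centrally_symmetric (T3 P).
Proof.
move=> cs k; have e n : P (k + 4 + n) = - P (k + n) by rewrite addrAC cs.
rewrite /T3 !e /meet.
have crossN2 (p q : 'rV[R]_2) : cross (- p) (- q) = cross p q.
  by rewrite crossNl crossNr opprK.
by rewrite -!opprD !crossN2 scalerN -opprD.
Qed.

(** The right-hand side is what survives an iteration: up to nonzero constants
    the products are x times [nextx] and y times [nexty]. *)
Lemma conic_factors_neq0 s x y (N := (1 + al ^+ 2) * x + 2 * y + 2 * s)
    (D := (1 + be ^+ 2) * y + 2 * x + 2 * s) : conic_eq al be s x y ->
  [/\ s + x + be * y != 0, s + y - al * x != 0,
      s + x - be * y != 0 & s + y + al * x != 0] <->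
  x * N != 0 /\ y * D != 0.
Proof.
move=> Q; have Q' : conic_eq be al s y x by rewrite /conic_eq Q; ring.
rewrite -(diag_prod Q) -(diag_prod Q') !mulf_eq0 !negb_or.
by split=> [[-> -> -> ->]|[/andP[-> ->] /andP[-> ->]]].
Qed.

Lemma T3_in_chart P t z : centrally_symmetric P -> t != 0 ->
  in_chart al be P t z -> T3_defined P ->
  exists2 t', t' != 0 & in_chart al be (turn (T3 P)) t' (- rate al be * z).
Proof.
move=> cs t0 hc hd.
have Q := coords_conic cs hc.
have h := (T3_defined_coords cs hc).1 hd.
have [] := (conic_factors_neq0 Q).1 h.
rewrite !mulf_eq0 !negb_or => /andP[x0 _] /andP[y0 _].
have := T3_coords cs hc hd; set c := next_scale _ _ _ _ _.
have c0 : c != 0.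
  case: h => n0 n1 n2 n3.
  apply: mulf_neq0; first by rewrite expf_neq0 // !mulf_eq0 !negb_or x0 y0.
  by rewrite invr_eq0 !mulf_neq0.
have uv0 : rootU al be + rootV al be != 0.
  by rewrite gt_eqF // addr_gt0 ?rootU_gt0 ?rootV_gt0.
move=> /=; set s := chart_s _ _ _; set x := chart_x _ _ _; set y := chart_y _ _ _.
have -> : nexts al be (t * s) (t * x) (t * y) = t * nexts al be s x y.
  by rewrite /nexts; ring.
have -> : nextx al be (t * s) (t * x) (t * y) = t * nextx al be s x y.
  by rewrite /nextx; ring.
have -> : nexty al be (t * s) (t * x) (t * y) = t * nexty al be s x y.
  by rewrite /nexty; ring.
have [-> -> ->] := next_chart al1 be1 z.
move=> hs; clearbody c; exists (c * t * (rootU al be + rootV al be) ^+ 2).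
  by apply: mulf_neq0; [exact: mulf_neq0|exact: expf_neq0].
have assoc (p q r w : R) : p * (q * (r * w)) = p * q * r * w by rewrite !mulrA.
by rewrite !assoc in hs.
Qed.

(** Each application of [T3] costs a shift of the labels by one, which commutes
    with [T3]. *)
Lemma iter_T3_in_chart P t z n : centrally_symmetric P -> t != 0 ->
  in_chart al be P t z -> (forall k, (k < n)%N -> T3_defined (iter k (@T3 R) P)) ->
  exists2 t', t' != 0 & in_chart al be (turn_by n%:R (iter n (@T3 R) P)) t'
                          ((- rate al be) ^+ n * z).
Proof.
move=> cs t0 hc; elim: n => [|n IH] hd.
  exists t => //; rewrite expr0 mul1r.
  by rewrite (_ : turn_by _ _ = P) //; apply/funext => i; rewrite /turn_by addr0.
have [|t' t'0 hc'] := IH; first by move=> k kn; apply: hd; exact: ltnW.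
have csn : centrally_symmetric (iter n (@T3 R) P).
  by elim: (n) => //= m; exact: cs_T3.
have [] := T3_in_chart (cs_turn_by n%:R csn) t'0 hc'.
  by apply/T3_defined_turn_by; exact: hd.
move=> t'' t''0; rewrite mulrA -exprS => hc''; exists t'' => //.
move: hc''; rewrite (_ : turn _ = turn_by n.+1%:R (iter n.+1 (@T3 R) P)) //.
by apply/funext => i; rewrite /turn T3_turn_by /turn_by -natr1 addrAC addrA.
Qed.

(** A region which is invariant because the linear map has positive
    coefficients, and on which [T3] is defined.  It spares any argument about
    the convexity of the iterates. *)
Definition chart_pos z : Prop :=
  [/\ 0 < chart_s al be z, 0 < chart_x al be z & 0 < chart_y al be z].

Lemma weighted_gt0 (p s x y : R) : 0 < s -> 0 < x -> 0 < y ->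
  0 < (1 + p ^+ 2) * x + 2 * y + 2 * s.
Proof.
move=> s0 x0 y0; apply: addr_gt0; last exact: mulr_gt0.
apply: addr_gt0; apply: mulr_gt0 => //.
by rewrite ltr_wpDr ?sqr_ge0.
Qed.

Lemma chart_pos_next z : chart_pos z -> chart_pos (- rate al be * z).
Proof.
case=> s0 x0 y0; have [es ex ey] := next_chart al1 be1 z.
have m0 : 0 < (rootU al be + rootV al be) ^+ 2.
  by rewrite exprn_gt0 // addr_gt0 ?rootU_gt0 ?rootV_gt0.
have A0 : 0 < 1 - al ^+ 2 by rewrite subr_gt0.
have B0 : 0 < 1 - be ^+ 2 by rewrite subr_gt0.
have al0 := sqr_ge0 al; have be0 := sqr_ge0 be.
have V0 := rootV_arg al1 be1.
split.
- rewrite -(pmulr_rgt0 _ m0) -es /nexts; apply: addr_gt0; apply: mulr_gt0 => //.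
  + by rewrite mulr_gt0.
  + exact: addr_gt0.
  + by move: (al ^+ 2) (be ^+ 2) A0 B0 V0 => p q; lra.
- rewrite -(pmulr_rgt0 _ m0) -ex /nextx; apply: mulr_gt0 => //.
  exact: weighted_gt0.
- rewrite -(pmulr_rgt0 _ m0) -ey /nexty; apply: mulr_gt0 => //.
  exact: weighted_gt0.
Qed.

Lemma chart_pos_defined P t z : centrally_symmetric P -> t != 0 ->
  in_chart al be P t z -> chart_pos z -> T3_defined P.
Proof.
move=> cs t0 hc [s0 x0 y0].
apply/(T3_defined_coords cs hc)/(conic_factors_neq0 (coords_conic cs hc)).
have al0 := sqr_ge0 al; have be0 := sqr_ge0 be.
rewrite !(mulrCA _ t) -!mulrDr; split.
- by rewrite !mulf_neq0 // gt_eqF // weighted_gt0.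
- by rewrite !mulf_neq0 // gt_eqF // weighted_gt0.
Qed.

Lemma iter_T3_defined P t z : centrally_symmetric P -> t != 0 ->
  in_chart al be P t z -> chart_pos z -> forall k, T3_defined (iter k (@T3 R) P).
Proof.
move=> cs t0 hc zpos.
have pos n : chart_pos ((- rate al be) ^+ n * z).
  elim: n => [|n IH]; first by rewrite expr0 mul1r.
  by rewrite exprS -mulrA; exact: chart_pos_next.
move=> k; have [n] := ubnP k; elim: n k => // n IH k; rewrite ltnS => kn.
have [t' t'0 hc'] : exists2 t', t' != 0 &
    in_chart al be (turn_by k%:R (iter k (@T3 R) P)) t' ((- rate al be) ^+ k * z).
  by apply: iter_T3_in_chart hc _ => // i ik; apply: IH; exact: leq_trans kn.
apply/(T3_defined_turn_by k%:R); apply: chart_pos_defined hc' (pos k) => //.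
by apply: cs_turn_by; elim: (k) => //= m; exact: cs_T3.
Qed.

End Orbit.

(** * Linear normal forms and convergence *)

Section NormalForm.
Variable R : realType.
Implicit Types (P : octagon R) (al be s x y t z : R) (a b p : 'rV[R]_2).

Lemma det2E (M : 'M[R]_2) : \det M = M 0 0 * M 1 1 - M 0 1 * M 1 0.
Proof.
rewrite (expand_det_row _ 0) !big_ord_recl big_ord0 addr0 /cofactor !det_mx11.
rewrite !mxE /= expr0 expr1.
have -> : lift 0 (0 : 'I_1) = 1 by exact/val_inj.
have -> : lift 1 (0 : 'I_1) = 0 by exact/val_inj.
by rewrite /= mul1r mulN1r mulrN.
Qed.

(** The inverse of the matrix with rows [a] and [b]: it takes vectors to their
    coordinates in the basis ([a], [b]), see [mul_frame]. *)
Definition frame a b : 'M[R]_2 := \matrix_(i, j)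
  ((if j == 0 then if i == 0 then b 0 1 else - b 0 0
    else if i == 0 then - a 0 1 else a 0 0) / cross a b).

Lemma mul_frame a b p : p *m frame a b =
  (cross p b / cross a b) *: delta_mx 0 0 + (cross a p / cross a b) *: delta_mx 0 1.
Proof.
by apply: row2P; rewrite !mxE !big_ord_recl big_ord0 !mxE /= /cross;
  rewrite (_ : lift ord0 ord0 = 1) ?mulr1 ?mulr0 ?addr0 ?add0r;
  [ring|exact/val_inj|ring|exact/val_inj].
Qed.

Lemma frame_unit a b : cross a b != 0 -> frame a b \in unitmx.
Proof.
move=> d0; rewrite unitmxE det2E !mxE /= unitfE.
rewrite (_ : _ - _ = (cross a b)^-1) ?invr_eq0 //.
by move: d0; rewrite /cross => d0; field.
Qed.

(** The representative of a linear class: the vertices 0 and 2 are the standard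
    basis, and Cramer's rule gives the other ones. *)
Definition normal_octagon al be s x y : octagon R := fun i =>
  let e0 := delta_mx 0 0 in let e1 := delta_mx 0 1 in
  let v1 := ((s - al * x + be * y) / (2 * x)) *: e0
            + ((s + al * x + be * y) / (2 * x)) *: e1 in
  let v3 := (- (s - al * x - be * y) / (2 * x)) *: e0
            + ((s + al * x - be * y) / (2 * x)) *: e1 in
  nth 0 [:: e0; v1; e1; v3; - e0; - v1; - e1; - v3] i.

Lemma normal_octagon_cs al be s x y :
  centrally_symmetric (normal_octagon al be s x y).
Proof. by apply: Z8_ind; rewrite /normal_octagon /= ?opprK. Qed.

Lemma normal_octagon_coords al be s x y (t := (2 * x)^-1) :
  x != 0 -> conic_eq al be s x y ->
  has_coords (normal_octagon al be s x y) al be (t * s) (t * x) (t * y).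
Proof.
move=> x0 Q; rewrite /t {t}.
split; first split; rewrite /normal_octagon /cross !mxE /=.
- by field.
- by field.
- by field.
- by field.
- by field.
- by field: Q.
Qed.

Lemma cs_normalise P al be s x y : centrally_symmetric P -> x != 0 ->
  has_coords P al be s x y ->
  forall i, P i *m frame (P 0) (P 2) = normal_octagon al be s x y i.
Proof.
move=> cs x0 hc; have [[e0 e1 e2 e3] f0 f1] := hc.
have h i : P i *m frame (P 0) (P 2) = normal_octagon al be s x y i ->
    P (i + 4) *m frame (P 0) (P 2) = normal_octagon al be s x y (i + 4).
  by rewrite cs normal_octagon_cs mulNmx => ->.
have cc (p : 'rV[R]_2) : cross p p = 0 by rewrite /cross; ring.
have d0 : 2 * x != 0 by rewrite mulf_neq0 // pnatr_eq0.
have h0 : P 0 *m frame (P 0) (P 2) = normal_octagon al be s x y 0.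
  by rewrite mul_frame cc f0 divff // mul0r scale0r addr0 scale1r.
have h1 : P 1 *m frame (P 0) (P 2) = normal_octagon al be s x y 1.
  by rewrite mul_frame f0 e0 e1.
have h2 : P 2 *m frame (P 0) (P 2) = normal_octagon al be s x y 2.
  by rewrite mul_frame cc f0 divff // mul0r scale0r add0r scale1r.
have h3 : P 3 *m frame (P 0) (P 2) = normal_octagon al be s x y 3.
  rewrite mul_frame f0 crossC e2 /normal_octagon /= -e3.
  rewrite (_ : P 4 = - P 0); last by rewrite -(cs 0); congr P; exact/val_inj.
  by rewrite crossNr -crossC.
apply: Z8_ind => //.
- by rewrite (_ : (4 : 'Z_8) = 0 + 4); [exact: h|exact/val_inj].
- by rewrite (_ : (5 : 'Z_8) = 1 + 4); [exact: h|exact/val_inj].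
- by rewrite (_ : (6 : 'Z_8) = 2 + 4); [exact: h|exact/val_inj].
- by rewrite (_ : (7 : 'Z_8) = 3 + 4); [exact: h|exact/val_inj].
Qed.

Section Limit.
Variables (al be : R).

Definition chart_octagon z : octagon R :=
  normal_octagon al be (chart_s al be z) (chart_x al be z) (chart_y al be z).

Lemma chart_octagon_cvg (z_ : nat -> R) : be ^+ 2 < 1 ->
  z_ @ \oo --> 0 -> forall i, (fun k => chart_octagon (z_ k) i) @ \oo --> chart_octagon 0 i.
Proof.
move=> be1 z0.
have z2 : (fun k => z_ k ^+ 2) @ \oo --> (0 : R) ^+ 2.
  by rewrite expr2; under eq_fun do rewrite expr2; exact: cvgM.
have s0 : (fun k => chart_s al be (z_ k)) @ \oo --> chart_s al be 0.
  by apply: cvgM; [exact: cvg_cst|apply: cvgB => //; exact: cvg_cst].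
have x0 : (fun k => chart_x al be (z_ k)) @ \oo --> chart_x al be 0.
  apply: cvgD; apply: cvgM => //; try exact: cvg_cst.
  by apply: cvgD => //; exact: cvg_cst.
have y0 : (fun k => chart_y al be (z_ k)) @ \oo --> chart_y al be 0.
  apply: cvgB; apply: cvgM => //; try exact: cvg_cst.
  by apply: cvgD => //; exact: cvg_cst.
have i0 : (fun k => (2 * chart_x al be (z_ k))^-1) @ \oo --> (2 * chart_x al be 0)^-1.
  apply: cvgV.
    rewrite /chart_x mulr0 expr0n addr0 addr0 mulr1 mulf_neq0 ?pnatr_eq0 //.
    by rewrite subr_eq0 gt_eqF.
  by apply: cvgM => //; exact: cvg_cst.
have ax : (fun k => al * chart_x al be (z_ k)) @ \oo --> al * chart_x al be 0.
  by apply: cvgM => //; exact: cvg_cst.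
have ay : (fun k => be * chart_y al be (z_ k)) @ \oo --> be * chart_y al be 0.
  by apply: cvgM => //; exact: cvg_cst.
pose L i := (fun k => chart_octagon (z_ k) i) @ \oo --> chart_octagon 0 i.
have L0 : L 0 by exact: cvg_cst.
have L2 : L 2 by exact: cvg_cst.
have L1 : L 1.
  apply: cvgD; apply: cvgZr_tmp; apply: cvgM => //.
  + by apply: cvgD => //; exact: cvgB.
  + by apply: cvgD => //; exact: cvgD.
have L3 : L 3.
  apply: cvgD; apply: cvgZr_tmp; apply: cvgM => //.
  + by apply: cvgN; apply: cvgB => //; exact: cvgB.
  + by apply: cvgB => //; exact: cvgD.
have LN i : L i -> L (i + 4).
  have cN z : chart_octagon z (i + 4) = - chart_octagon z i.
    exact: normal_octagon_cs.
  by rewrite /L cN => h; under eq_fun do rewrite cN; exact: cvgN.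
have L4 : L 4 by rewrite (_ : (4 : 'Z_8) = 0 + 4); [exact: LN|exact/val_inj].
have L5 : L 5 by rewrite (_ : (5 : 'Z_8) = 1 + 4); [exact: LN|exact/val_inj].
have L6 : L 6 by rewrite (_ : (6 : 'Z_8) = 2 + 4); [exact: LN|exact/val_inj].
have L7 : L 7 by rewrite (_ : (7 : 'Z_8) = 3 + 4); [exact: LN|exact/val_inj].
exact: (Z8_ind (Q := L)).
Qed.

End Limit.
End NormalForm.

(** * Change of coordinates for conics, and Poncelet octagons *)

Section Conics.
Variable R : realType.
Implicit Types (P : octagon R) (C D : 'M[R]_3) (F : 'M[R]_2) (a b p : 'rV[R]_2).

Definition homog_map F : 'M[R]_3 := block_mx F 0 0 (1%:M : 'M[R]_1).

Lemma homog_mapE F p : homog p *m homog_map F = homog (p *m F).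
Proof.
have := mul_row_block p 1 F 0 0 (1%:M : 'M[R]_1).
by rewrite !mulmx0 addr0 add0r mulmx1.
Qed.

Lemma homog_map_unit F : F \in unitmx -> homog_map F \in unitmx.
Proof.
by have := det_ublock F 0 (1%:M : 'M[R]_1); rewrite det1 mulr1 !unitmxE => ->.
Qed.

Definition pullback F C := homog_map F *m C *m (homog_map F)^T.

Lemma on_conic_pullback F C x :
  on_conic (pullback F C) x <-> on_conic C (x *m homog_map F).
Proof. by rewrite /on_conic /pullback trmx_mul !mulmxA. Qed.

Lemma is_conic_pullback F C : F \in unitmx -> is_conic C -> is_conic (pullback F C).
Proof.
move=> /homog_map_unit uT [sC uC [x x0 xC]]; split.
- by rewrite /pullback !trmx_mul trmxK sC mulmxA.
- by rewrite !unitmx_mul unitmx_tr uT uC.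
exists (x *m invmx (homog_map F)); last by rewrite on_conic_pullback mulmxKV.
apply: contra_neq x0 => e; by rewrite -(mulmxKV uT x) e mul0mx.
Qed.

Lemma line_tangent_pullback F C a b : F \in unitmx ->
  line_tangent C (a *m F) (b *m F) -> line_tangent (pullback F C) a b.
Proof.
move=> /homog_map_unit uT [ab [x [x0 xC xa xb]]]; split.
  by apply: contra_neq ab => ->.
exists (x *m invmx (homog_map F)); split.
- apply: contra_neq x0 => e; by rewrite -(mulmxKV uT x) e mul0mx.
- by rewrite on_conic_pullback mulmxKV.
- by rewrite /on_tangent_at /pullback !mulmxA mulmxKV // -mulmxA -trmx_mul homog_mapE.
- by rewrite /on_tangent_at /pullback !mulmxA mulmxKV // -mulmxA -trmx_mul homog_mapE.
Qed.

Lemma inscribed_pullback F C P :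
  inscribed (fun i => P i *m F) C -> inscribed P (pullback F C).
Proof. by move=> h k; rewrite on_conic_pullback homog_mapE; exact: h. Qed.

Lemma circumscribed_pullback F C P : F \in unitmx ->
  circumscribed (fun i => P i *m F) C -> circumscribed P (pullback F C).
Proof. by move=> uF h k; apply: line_tangent_pullback => //; exact: h. Qed.

Lemma homogEl p (i : 'I_2) : homog p 0 (lshift 1 i) = p 0 i.
Proof. exact: (@row_mxEl R 1 2 1 p 1 0 i). Qed.

Lemma homogEr p : homog p 0 (rshift 2 0) = 1.
Proof. by apply: etrans (@row_mxEr R 1 2 1 p 1 0 0) _; rewrite mxE eqxx. Qed.

Lemma homog_free2 a b : a != b -> row_free (col_mx (homog a) (homog b)).
Proof.
move=> ab; apply: inj_row_free => v; rewrite -[v]hsubmxK mul_row_col.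
rewrite (mx11_scalar (lsubmx v)) (mx11_scalar (rsubmx v)).
move: (lsubmx v 0 0) (rsubmx v 0 0) => l r; rewrite !mul_scalar_mx => e.
have comb j : l * homog a 0 j + r * homog b 0 j = 0.
  transitivity ((l *: homog a + r *: homog b) 0 j); last by rewrite e mxE.
  by rewrite !mxE.
have r_l : r = - l.
  have := comb (rshift 2 0); rewrite !homogEr !mulr1 => /eqP.
  by rewrite addrC addr_eq0 => /eqP.
suff l0 : l = 0 by rewrite r_l l0 oppr0 !raddf0 row_mx0.
apply: contraNeq ab => l0; apply/eqP/rowP => i.
have := comb (lshift 1 i); rewrite r_l !homogEl => h.
by apply: (mulfI l0); apply/eqP; rewrite -subr_eq0 -mulNr h.
Qed.

(** The line ab would be totally isotropic for a nondegenerate form in three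
    variables: the point of contact lies on it, and being conjugate to [a] and
    [b] it forces [a] and [b] to be conjugate to each other. *)
Lemma tangent_two_points C a b : is_conic C -> line_tangent C a b ->
  on_conic C (homog a) -> on_conic C (homog b) -> False.
Proof.
move=> [sC uC _] [ab [x [x0 xC xa xb]]] aC bC.
set W := col_mx (homog a) (homog b).
have rW : \rank W = 2 by apply/eqP; exact: homog_free2.
have xW : (x <= W)%MS.
  have WW : (W <= col_mx x W)%MS by rewrite -(addsmxE x W) addsmxSr.
  have : \rank (col_mx x W) = \rank W.
    apply/eqP; rewrite eqn_leq; apply/andP; split; last exact: mxrankS.
    rewrite rW.
    have : col_mx x W *m (C *m x^T) = 0.
      have sw y : y *m (C *m x^T) = (x *m C *m y^T)^T.
        by rewrite !trmx_mul trmxK sC.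
      rewrite /W !mul_col_mx !sw.
      rewrite /on_tangent_at in xa xb; rewrite /on_conic in xC.
      by rewrite xa xb xC !trmx0 !col_mx0.
    move/mulmx0_rank_max; rewrite (eqmxMfull x^T) ?row_full_unit //.
    have : (0 < \rank x^T)%N by rewrite mxrank_tr lt0n mxrank_eq0.
    by case: (\rank x^T) => // n _; rewrite addnS ltnS => h; apply: leq_trans h; exact: leq_addr.
  move=> e; have := mxrank_leqif_sup WW; rewrite e => -[_ /esym]; rewrite eqxx => h.
  by apply: submx_trans h; rewrite -(addsmxE x W) addsmxSl.
have [l lx] := submxP xW.
rewrite -[l]hsubmxK /W mul_row_col in lx.
set y := lsubmx l in lx; set z := rsubmx l in lx.
have ba : homog b *m C *m (homog a)^T = (homog a *m C *m (homog b)^T)^T.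
  by rewrite !trmx_mul trmxK sC mulmxA.
have ab0 : homog a *m C *m (homog b)^T = 0.
  rewrite /on_tangent_at lx in xa xb.
  rewrite !mulmxDl -!mulmxA !(mulmxA (homog _)) aC mulmx0 add0r ba in xa.
  rewrite !mulmxDl -!mulmxA !(mulmxA (homog _)) bC mulmx0 addr0 in xb.
  rewrite -!mulmxA !(mulmxA (homog _)) in xa xb.
  set M := homog a *m C *m (homog b)^T in xa xb ba *.
  have [//|M0] := eqVneq M 0.
  have uM : M \in unitmx.
    rewrite unitmxE unitfE det_mx11; apply: contra_neq M0 => e.
    by rewrite (mx11_scalar M) e raddf0.
  have z0 : z = 0.
    have uMt : M^T \in unitmx by rewrite unitmx_tr.
    by rewrite -(mulmxK uMt z) xa mul0mx.
  have y0 : y = 0 by rewrite -(mulmxK uM y) xb mul0mx.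
  by move/eqP: x0; case; rewrite lx y0 z0 !mul0mx addr0.
have WCW : W *m (C *m W^T) = 0.
  rewrite /W tr_col_mx mul_mx_row mul_col_mx !mul_mx_row !mulmxA.
  by rewrite aC bC ba ab0 trmx0 !row_mx0 col_mx0.
have := mulmx0_rank_max WCW.
by rewrite (eqmxMfull W^T) ?row_full_unit // mxrank_tr rW.
Qed.

(** The two conics cannot be proportional, since an edge would be a tangent
    line with two points on the conic. *)
Lemma inscribed_circumscribed_Poncelet P C D : is_conic C -> is_conic D ->
  inscribed P C -> circumscribed P D -> Poncelet P.
Proof.
move=> cC cD iC cirD; exists C, D; split=> // -[c Dc].
have on k : on_conic D (homog (P k)).
  by rewrite /on_conic Dc -scalemxAr -scalemxAl iC scaler0.
exact: tangent_two_points cD (cirD 0) (on _) (on _).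
Qed.

End Conics.

(** * Conics centred at the origin *)

Section CentralConics.
Variable R : realType.
Implicit Types (p q r : R) (a b w : 'rV[R]_2).

Definition qform p q r a b : R :=
  p * a 0 0 * b 0 0 + q * (a 0 0 * b 0 1 + a 0 1 * b 0 0) + r * a 0 1 * b 0 1.

Definition gram p q r : 'M[R]_2 :=
  \matrix_(i, j) if i == j then if i == 0 then p else r else q.

Definition central_conic p q r d : 'M[R]_3 :=
  block_mx (gram p q r) 0 0 ((- d)%:M : 'M[R]_1).

Lemma central_conicE p q r d a b :
  homog a *m central_conic p q r d *m (homog b)^T = (qform p q r a b - d)%:M.
Proof.
have e1 := mul_row_block a 1 (gram p q r) 0 0 ((- d)%:M : 'M[R]_1).
have e2 := tr_row_mx b (1 : 'M[R]_1).
have e3 := mul_row_col (a *m gram p q r) ((- d)%:M : 'M[R]_1) b^T (1 : 'M[R]_1)^T.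
rewrite !mulmx0 addr0 add0r mul1mx in e1.
rewrite -e1 -e2 in e3; apply: (etrans e3).
rewrite trmx1 mulmx1; apply/matrixP => i j; rewrite !ord1 !mxE.
rewrite !big_ord_recl !big_ord0 !mxE !big_ord_recl !big_ord0 !mxE /= /qform.
have -> : lift ord0 ord0 = 1 :> 'I_2 by exact/val_inj.
by rewrite /= !mulr1n; ring.
Qed.

Lemma on_central_conic p q r d a :
  qform p q r a a = d -> on_conic (central_conic p q r d) (homog a).
Proof. by rewrite /on_conic central_conicE => ->; rewrite subrr raddf0. Qed.

Lemma central_conic_is_conic p q r d a : p * r - q ^+ 2 != 0 -> d != 0 ->
  qform p q r a a = d -> is_conic (central_conic p q r d).
Proof.
move=> D0 d0 ad; split.
- rewrite /central_conic.
  have := tr_block_mx (gram p q r) 0 0 ((- d)%:M : 'M[R]_1).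
  rewrite !trmx0 tr_scalar_mx => e; apply: (etrans e); congr block_mx.
  by apply/matrixP => i j; rewrite !mxE eq_sym; case: eqP => // ->.
- rewrite unitmxE.
  have := det_ublock (gram p q r) 0 ((- d)%:M : 'M[R]_1).
  rewrite det2E det_mx11 !mxE /= mulr1n => e; rewrite /central_conic e unitfE.
  by rewrite mulf_neq0 ?oppr_eq0 // -expr2.
- exists (homog a); last exact: on_central_conic.
  apply: contraTneq (oner_neq0 R) => e.
  by have := homogEr a; rewrite e mxE => /eqP; rewrite eq_sym => ->.
Qed.

(** [w] is the point of the line ab which is conjugate to the direction of the
    line.  By the identity of Lagrange its [qform] is the square of
    [cross a b] divided by the [qform] of [b - a], times the determinant; the
    hypothesis says that this is the determinant, so that [w] is the point of
    contact. *)
Lemma central_conic_tangent p q r a b : cross a b != 0 ->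
  qform p q r (b - a) (b - a) = cross a b ^+ 2 ->
  let w := a - (qform p q r a (b - a) / cross a b ^+ 2) *: (b - a) in
  qform p q r w w = p * r - q ^+ 2 /\
  line_tangent (central_conic p q r (p * r - q ^+ 2)) a b.
Proof.
move=> ab0 e w.
set t := qform p q r a (b - a) / _ in w *.
set d := p * r - q ^+ 2.
have lag (u v : 'rV[R]_2) : qform p q r u u * qform p q r v v
    = qform p q r u v ^+ 2 + d * cross u v ^+ 2.
  by rewrite /qform /d /cross; ring.
have ab02 : cross a b ^+ 2 != 0 by rewrite expf_neq0.
have cu : cross a (b - a) = cross a b by rewrite /cross !mxE; ring.
have wE c : qform p q r w c = qform p q r a c - t * qform p q r (b - a) c.
  by rewrite /w /qform !mxE; ring.
have sym u v : qform p q r u v = qform p q r v u by rewrite /qform; ring.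
have tE : t * cross a b ^+ 2 = qform p q r a (b - a) by rewrite divfK.
have wu : qform p q r w (b - a) = 0 by rewrite wE e tE subrr.
have wa : qform p q r w a = d.
  apply: (mulIf ab02); have := lag a (b - a); rewrite e cu => h.
  transitivity (qform p q r a a * cross a b ^+ 2
                - t * cross a b ^+ 2 * qform p q r (b - a) a).
    by rewrite wE; ring.
  by rewrite tE (sym (b - a)) h; ring.
have wb : qform p q r w b = d.
  have -> : qform p q r w b = qform p q r w a + qform p q r w (b - a).
    by clearbody w; rewrite /qform !mxE; ring.
  by rewrite wa wu addr0.
have ww : qform p q r w w = d.
  rewrite [LHS](_ : _ = qform p q r w a - t * qform p q r w (b - a)); last first.
    by rewrite {2}/w /qform !mxE; ring.
  by rewrite wu mulr0 subr0 wa.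
split=> //; split.
  by apply: contra_neq ab0 => ->; rewrite /cross; ring.
exists (homog w); split.
- apply: contraTneq (oner_neq0 R) => h.
  by have := homogEr w; rewrite h mxE => /eqP; rewrite eq_sym => ->.
- exact: on_central_conic.
- by rewrite /on_tangent_at central_conicE wa subrr raddf0.
- by rewrite /on_tangent_at central_conicE wb subrr raddf0.
Qed.

End CentralConics.

(** * The conics of a Poncelet octagon *)

Section PonceletConics.
Variable R : realType.
Variables (al be s x y : R).
Hypotheses (Q : conic_eq al be s x y) (x0 : x != 0) (y0 : y != 0).
Hypotheses (al1 : 1 - al ^+ 2 != 0) (be1 : 1 - be ^+ 2 != 0).
Hypothesis V0 : 1 - al ^+ 2 * be ^+ 2 != 0.

Local Notation N := (normal_octagon al be s x y).
Let a0 := s + al * x + be * y.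
Let a1 := s - al * x + be * y.
Let a2 := s - al * x - be * y.
Let a3 := s + al * x - be * y.

Lemma sides_prod : a0 * a1 * (a2 * a3) = 4 * x ^+ 2 * y ^+ 2 * (1 - al ^+ 2 * be ^+ 2).
Proof. by rewrite /a0 /a1 /a2 /a3; move: Q; rewrite /conic_eq => h; ring: h. Qed.

Lemma sides_neq0 : [/\ a0 != 0, a1 != 0, a2 != 0 & a3 != 0].
Proof.
have : a0 * a1 * (a2 * a3) != 0.
  by rewrite sides_prod !mulf_neq0 // ?pnatr_eq0 // expf_neq0.
by rewrite !mulf_eq0 !negb_or => /andP[/andP[-> ->] /andP[-> ->]].
Qed.

(** A form with value 1 at the vertices 0 and 2 has one free coefficient [m].
    Vertex 1 fixes [m], and vertex 3 fixes it too; the two values agree exactly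
    when (1 - al^2) x = (1 - be^2) y, that is z = 0. *)
Lemma normal_inscribed : (1 - al ^+ 2) * x = (1 - be ^+ 2) * y ->
  exists2 C, is_conic C & inscribed N C.
Proof.
move=> e.
have [n0 n1 n2 n3] := sides_neq0.
pose A := 1 - al ^+ 2.
pose m := 2 * A * x ^+ 2 / (a0 * a1) - 1.
pose K1 := 2 * A * x ^+ 2 / (a0 * a1); pose K2 := 2 * A * x ^+ 2 / (a2 * a3).
have key : A * x ^+ 2 * (a0 * a1 + a2 * a3) = a0 * a1 * (a2 * a3).
  rewrite sides_prod.
  transitivity (4 * x ^+ 2 * y * (A * x + A * be ^+ 2 * y)).
    by move: Q; rewrite /conic_eq /A /a0 /a1 /a2 /a3 => h; ring: h.
  by rewrite /A e; ring.
have K12 : K1 + K2 = 2.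
  transitivity (2 * (A * x ^+ 2 * (a0 * a1 + a2 * a3)) / (a0 * a1 * (a2 * a3))).
    by rewrite /K1 /K2; field; rewrite n0 n1 n2 n3.
  by rewrite key; field; rewrite n0 n1 n2 n3.
have m1 : m * (a0 * a1) = 2 * A * x ^+ 2 - a0 * a1.
  by rewrite /m; field; rewrite n0 n1.
have m2 : m * (a2 * a3) = a2 * a3 - 2 * A * x ^+ 2.
  have -> : m = 1 - K2 by rewrite /m -/K1 -(addrK K2 K1) K12; ring.
  by rewrite /K2; field; rewrite n2 n3.
have D0 : 1 * 1 - m ^+ 2 != 0.
  have -> : 1 * 1 - m ^+ 2 = K1 * K2.
    by rewrite /m -/K1 -[K2](addKr K1) K12; ring.
  by rewrite !mulf_neq0 // ?pnatr_eq0 ?invr_eq0 ?mulf_neq0 // ?expf_neq0.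
pose e0 : 'rV[R]_2 := delta_mx 0 0.
have E0 : qform 1 m 1 e0 e0 = 1 by rewrite /qform !mxE /=; ring.
exists (central_conic 1 m 1 1).
  by apply: (central_conic_is_conic D0 _ E0); exact: oner_neq0.
have qN (w : 'rV[R]_2) : qform 1 m 1 (- w) (- w) = qform 1 m 1 w w.
  by rewrite /qform !mxE; ring.
have h1 : qform 1 m 1 (N 1) (N 1) = 1.
  transitivity ((a1 ^+ 2 + a0 ^+ 2 + 2 * (m * (a0 * a1))) / (2 * x) ^+ 2).
    by rewrite /qform /normal_octagon !mxE /= -/a0 -/a1; field.
  by rewrite m1 /a0 /a1 /A; field.
have h3 : qform 1 m 1 (N 3) (N 3) = 1.
  transitivity ((a2 ^+ 2 + a3 ^+ 2 - 2 * (m * (a2 * a3))) / (2 * x) ^+ 2).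
    by rewrite /qform /normal_octagon !mxE /= -/a2 -/a3; field.
  by rewrite m2 /a2 /a3 /A; field.
have h2 : qform 1 m 1 (N 2) (N 2) = 1.
  by rewrite /qform /normal_octagon !mxE /=; ring.
have h4 : qform 1 m 1 (N 4) (N 4) = 1 by rewrite -[RHS]E0 -[RHS]qN.
have h5 : qform 1 m 1 (N 5) (N 5) = 1 by rewrite -[RHS]h1 -[RHS]qN.
have h6 : qform 1 m 1 (N 6) (N 6) = 1 by rewrite -[RHS]h2 -[RHS]qN.
have h7 : qform 1 m 1 (N 7) (N 7) = 1 by rewrite -[RHS]h3 -[RHS]qN.
move=> k; apply: on_central_conic; move: k; exact: Z8_ind.
Qed.

(** By [central_conic_tangent] the form must take the value a_k^2 at the
    direction of the k-th edge.  These are four linear equations for three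
    coefficients, compatible because a0 + a2 = a1 + a3; [p], [q], [r] below
    are their solution. *)
Lemma normal_circumscribed : x + y != s -> exists2 D, is_conic D & circumscribed N D.
Proof.
rewrite -subr_eq0 => hs.
have [n0 n1 n2 n3] := sides_neq0.
have x2 : 2 * x != 0 by rewrite mulf_neq0 // pnatr_eq0.
(* The determinant of the form is a square times
   (1 - al^2) (1 - be^2), which keeps the conic nondegenerate. *)
pose p := a0 * a3 * (1 - al) / (4 * x * (x + y - s)).
pose r := a1 * a2 * (1 + al) / (4 * x * (x + y - s)).
pose q := - be * y * (1 - al ^+ 2) / (2 * (x + y - s)).
have D : p * r - q ^+ 2 =
    (1 - al ^+ 2) * (1 - be ^+ 2) * y ^+ 2 / (4 * (x + y - s) ^+ 2).
  rewrite /p /q /r /a0 /a1 /a2 /a3; field: Q; by rewrite ?hs ?x0.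
have D0 : p * r - q ^+ 2 != 0.
  by rewrite D !mulf_neq0 // ?invr_eq0 ?expf_neq0 ?mulf_neq0 ?expf_neq0 // pnatr_eq0.
pose good (a b : 'rV[R]_2) :=
  cross a b != 0 /\ qform p q r (b - a) (b - a) = cross a b ^+ 2.
have goodN a b : good a b -> good (- a) (- b).
  have cN : cross (- a) (- b) = cross a b by rewrite /cross !mxE; ring.
  rewrite /good cN => -[h1 h2]; split=> //; rewrite -h2 /qform !mxE; ring.
have [[c0 c1 c2 c3] _ _] := normal_octagon_coords x0 Q.
have t0 : (2 * x)^-1 != 0 by rewrite invr_eq0.
have g0 : good (N 0) (N 1).
  split.
    by rewrite (_ : cross _ _ = a0 / (2 * x)) ?mulf_neq0 // c0 /a0; ring.
  rewrite /qform /cross /normal_octagon !mxE /= /p /q /r /a0 /a1 /a2 /a3.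
  by field: Q; rewrite ?hs ?x0.
have g1 : good (N 1) (N 2).
  split.
    by rewrite (_ : cross _ _ = a1 / (2 * x)) ?mulf_neq0 // c1 /a1; ring.
  rewrite /qform /cross /normal_octagon !mxE /= /p /q /r /a0 /a1 /a2 /a3.
  by field: Q; rewrite ?hs ?x0.
have g2 : good (N 2) (N 3).
  split.
    by rewrite (_ : cross _ _ = a2 / (2 * x)) ?mulf_neq0 // c2 /a2; ring.
  rewrite /qform /cross /normal_octagon !mxE /= /p /q /r /a0 /a1 /a2 /a3.
  by field: Q; rewrite ?hs ?x0.
have g3 : good (N 3) (N 4).
  split.
    by rewrite (_ : cross _ _ = a3 / (2 * x)) ?mulf_neq0 // c3 /a3; ring.
  rewrite /qform /cross /normal_octagon !mxE /= /p /q /r /a0 /a1 /a2 /a3.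
  by field: Q; rewrite ?hs ?x0.
have good_all k : good (N k) (N (k + 1)).
  move: k; apply: Z8_ind.
  - by rewrite add0r.
  - exact: g1.
  - exact: g2.
  - exact: g3.
  - exact: (goodN _ _ g0).
  - exact: (goodN _ _ g1).
  - exact: (goodN _ _ g2).
  - by have := goodN _ _ g3; rewrite /normal_octagon /= opprK.
exists (central_conic p q r (p * r - q ^+ 2)).
  have [h1 h2] := good_all 0.
  have [ww _] := central_conic_tangent h1 h2.
  exact: central_conic_is_conic ww.
by move=> k; have [h1 h2] := good_all k; case: (central_conic_tangent h1 h2).
Qed.

End PonceletConics.

(** * Circumscribed octagons have a0 + a2 = a1 + a3 *)

Section Pitot.
Variable R : realType.
Implicit Types (P : octagon R) (E : 'M[R]_3) (a b c u v : 'rV[R]_2) (p q r : R).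

Lemma qform_lagrange p q r u v : qform p q r u u * qform p q r v v
  = qform p q r u v ^+ 2 + (p * r - q ^+ 2) * cross u v ^+ 2.
Proof. by rewrite /qform /cross; ring. Qed.

(** The two tangent segments at the vertex [b] are equal.  Lagrange's identity
    gives the equality of their squares.  If the signed lengths agreed, [b] would
    be orthogonal to [m - n], the difference of the two unit directions, and
    also parallel to it, so the two directions would coincide. *)
Lemma tangent_lengths p q r a b c : 0 < p * r - q ^+ 2 ->
  cross a b != 0 -> cross b c != 0 -> cross (b - a) (c - b) != 0 ->
  qform p q r (b - a) (b - a) = cross a b ^+ 2 ->
  qform p q r (c - b) (c - b) = cross b c ^+ 2 ->
  qform p q r b (b - a) / cross a b = - (qform p q r b (c - b) / cross b c).
Proof.
move=> d0 ab0 bc0 abc0 ab bc.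
pose m := (cross a b)^-1 *: (b - a); pose n := (cross b c)^-1 *: (c - b).
have qmm : qform p q r m m = 1.
  transitivity (qform p q r (b - a) (b - a) / cross a b ^+ 2).
    by rewrite /m /qform !mxE; field.
  by rewrite ab divff // expf_neq0.
have qnn : qform p q r n n = 1.
  transitivity (qform p q r (c - b) (c - b) / cross b c ^+ 2).
    by rewrite /n /qform !mxE; field.
  by rewrite bc divff // expf_neq0.
have cm : cross b m = 1.
  by move: ab0; rewrite /m /cross !mxE => ab0; field.
have cn : cross b n = 1.
  by move: bc0; rewrite /n /cross !mxE => bc0; field.
have mn : cross m n != 0.
  rewrite (_ : cross m n = cross (b - a) (c - b) / (cross a b * cross b c)).
    by rewrite mulf_neq0 // invr_eq0 mulf_neq0.
  rewrite /m /n [cross (b - a) (c - b)]/cross [cross (_ *: _) _]/cross !mxE.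
  by field; rewrite ab0 bc0.
have -> : qform p q r b (b - a) / cross a b = qform p q r b m.
  by rewrite /m /qform !mxE; ring.
have -> : qform p q r b (c - b) / cross b c = qform p q r b n.
  by rewrite /n /qform !mxE; ring.
have := qform_lagrange p q r b m; have := qform_lagrange p q r b n.
rewrite qmm qnn cm cn mulr1 expr1n mulr1 => bn bm.
have : qform p q r b m ^+ 2 == qform p q r b n ^+ 2.
  by rewrite -(addIr _ (etrans (esym bm) bn)).
rewrite eqf_sqr => /orP[/eqP bmn|/eqP //].
have b0 : qform p q r b b != 0 by rewrite gt_eqF // bn ltr_wpDl // sqr_ge0.
(* The form is definite, so [m] and [n] would be equal, against [cross m n != 0]. *)
have w0 : qform p q r (m - n) (m - n) = 0.
  apply: (mulfI b0); rewrite mulr0 qform_lagrange.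
  have -> : qform p q r b (m - n) = qform p q r b m - qform p q r b n.
    by rewrite /qform !mxE; ring.
  have -> : cross b (m - n) = cross b m - cross b n by rewrite /cross !mxE; ring.
  by rewrite bmn cm cn !subrr expr0n mulr0 addr0.
have := qform_lagrange p q r (m - n) m; rewrite w0 mul0r => /esym/eqP.
rewrite paddr_eq0 ?sqr_ge0 //; last by rewrite mulr_ge0 ?sqr_ge0 // ltW.
move=> /andP[_]; rewrite mulf_eq0 (gt_eqF d0) /= sqrf_eq0.
rewrite (_ : cross (m - n) m = cross m n) ?(negPf mn) //.
by rewrite /cross !mxE; ring.
Qed.

(** Every side is the sum of the two tangent segments on its edge, and adjacent
    edges share a length; the alternating sum of the sides vanishes. *)
Lemma pitot P p q r : centrally_symmetric P -> 0 < p * r - q ^+ 2 ->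
  (forall k, side P k != 0) ->
  (forall k, cross (P (k + 1) - P k) (P (k + 2) - P (k + 1)) != 0) ->
  (forall k, qform p q r (P (k + 1) - P k) (P (k + 1) - P k) = side P k ^+ 2) ->
  side P 0 + side P 2 = side P 1 + side P 3.
Proof.
move=> cs d0 a0 uu qu.
pose T k := qform p q r (P k) (P (k + 1) - P k) / side P k.
have T4 : T 4 = T 0.
  have e4 k : P (4 + k) = - P k by rewrite addrC cs.
  have e4' : P 4 = - P 0 by rewrite -(e4 0) addr0.
  rewrite /T /side !e4 e4' !add0r crossNl crossNr !opprK.
  by congr (_ / _); rewrite /qform !mxE; ring.
have sideE k : side P k = - T (k + 1) - T k.
  have i2 : k + 1 + 1 = k + 2 by ring.
  have ak := a0 (k + 1); have qk := qu (k + 1).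
  rewrite /side i2 in ak qk.
  rewrite /T /side i2 -(tangent_lengths d0 (a0 k) ak (uu k) (qu k) qk).
  rewrite -mulrBl -/(side P k).
  transitivity (qform p q r (P (k + 1) - P k) (P (k + 1) - P k) / side P k).
    by rewrite qu expr2 mulfK.
  by congr (_ / _); rewrite /qform !mxE; ring.
rewrite !sideE.
rewrite (_ : (3 : 'Z_8) + 1 = 4); last exact/val_inj.
rewrite (_ : (2 : 'Z_8) + 1 = 3); last exact/val_inj.
rewrite (_ : (1 : 'Z_8) + 1 = 2); last exact/val_inj.
by rewrite T4 add0r; ring.
Qed.

End Pitot.

(** * From an ellipse to a quadratic form on directions *)

Section Ellipse.
Variable R : realType.
Implicit Types (P : octagon R) (E : 'M[R]_3) (a b : 'rV[R]_2).

Lemma form3E E (x y : 'rV[R]_3) : (x *m E *m y^T) 0 0 =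
  (x 0 0 * E 0 0 + x 0 1 * E 1 0 + x 0 2 * E 2 0) * y 0 0
  + (x 0 0 * E 0 1 + x 0 1 * E 1 1 + x 0 2 * E 2 1) * y 0 1
  + (x 0 0 * E 0 2 + x 0 1 * E 1 2 + x 0 2 * E 2 2) * y 0 2.
Proof.
rewrite !mxE !big_ord_recl big_ord0 !mxE !big_ord_recl !big_ord0.
have -> : lift ord0 ord0 = 1 :> 'I_3 by exact/val_inj.
have -> : lift ord0 (lift ord0 ord0) = 2 :> 'I_3 by exact/val_inj.
by ring.
Qed.

Lemma homogE3 a : [/\ homog a 0 0 = a 0 0, homog a 0 1 = a 0 1 & homog a 0 2 = 1].
Proof.
split; [rewrite -(homogEl a 0)|rewrite -(homogEl a 1)|rewrite -(homogEr a)];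
  congr (homog a 0 _); exact/val_inj.
Qed.

Lemma at_infinityE3 a :
  [/\ at_infinity a 0 0 = a 0 0, at_infinity a 0 1 = a 0 1 & at_infinity a 0 2 = 0].
Proof.
have hl (i : 'I_2) : at_infinity a 0 (lshift 1 i) = a 0 i.
  exact: (@row_mxEl R 1 2 1 a 0 0 i).
have hr : at_infinity a 0 (rshift 2 (0 : 'I_1)) = 0.
  by apply: etrans (@row_mxEr R 1 2 1 a 0 0 0) _; rewrite mxE.
split; [rewrite -(hl 0)|rewrite -(hl 1)|rewrite -hr];
  congr (at_infinity a 0 _); exact/val_inj.
Qed.

Lemma sym_entries E i j : E^T = E -> E i j = E j i.
Proof. by move=> sE; rewrite -[in LHS]sE mxE. Qed.

(** The left-hand side is the adjugate of [E], that is the dual conic, at the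
    line through [a] and [b]. *)
Lemma line_tangent_dual E a b : E^T = E -> E \in unitmx -> line_tangent E a b ->
  (E 1 1 * E 2 2 - E 1 2 ^+ 2) * (b - a) 0 1 ^+ 2
  - 2 * (E 0 2 * E 1 2 - E 0 1 * E 2 2) * (b - a) 0 0 * (b - a) 0 1
  + (E 0 0 * E 2 2 - E 0 2 ^+ 2) * (b - a) 0 0 ^+ 2
  + 2 * cross a b * ((E 0 1 * E 0 2 - E 0 0 * E 1 2) * (b - a) 0 0
                     - (E 0 1 * E 1 2 - E 0 2 * E 1 1) * (b - a) 0 1)
  + (E 0 0 * E 1 1 - E 0 1 ^+ 2) * cross a b ^+ 2 = 0.
Proof.
move=> sE uE [ab [x [x0 xx xa xb]]].
have [ha0 ha1 ha2] := homogE3 a; have [hb0 hb1 hb2] := homogE3 b.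
have := congr1 (fun M : 'M[R]_1 => M 0 0) xx.
have := congr1 (fun M : 'M[R]_1 => M 0 0) xa.
have := congr1 (fun M : 'M[R]_1 => M 0 0) xb.
have z00 : (0 : 'M[R]_1) 0 0 = 0 by rewrite mxE.
rewrite !form3E z00 ha0 ha1 ha2 hb0 hb1 hb2.
rewrite (sym_entries 1 0 sE) (sym_entries 2 0 sE) (sym_entries 2 1 sE).
set l0 := _ + x 0 2 * E 0 2; set l1 := _ + x 0 2 * E 1 2; set l2 := _ + x 0 2 * E 2 2.
have l_neq0 : ~ [/\ l0 = 0, l1 = 0 & l2 = 0].
  move=> [e0 e1 e2]; move/eqP: x0; apply.
  have xE0 : x *m E = 0.
    apply/rowP => j; rewrite !mxE !big_ord_recl big_ord0.
    have -> : lift ord0 ord0 = 1 :> 'I_3 by exact/val_inj.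
    have -> : lift ord0 (lift ord0 ord0) = 2 :> 'I_3 by exact/val_inj.
    rewrite addr0 addrA.
    have [->|[->|->]] : j = 0 \/ j = 1 \/ j = 2.
      case: j => [[|[|[|//]]]] jlt; [left|right; left|right; right]; exact/val_inj.
    - by rewrite -[RHS]e0 /l0 (sym_entries 1 0 sE) (sym_entries 2 0 sE).
    - by rewrite -[RHS]e1 /l1 (sym_entries 2 1 sE).
    - by rewrite -[RHS]e2 /l2.
  by rewrite -(mulmxK uE x) xE0 mul0mx.
move=> lb la lx.
have adj : (E 1 1 * E 2 2 - E 1 2 ^+ 2) * l0 ^+ 2
  + 2 * (E 0 2 * E 1 2 - E 0 1 * E 2 2) * l0 * l1
  + (E 0 0 * E 2 2 - E 0 2 ^+ 2) * l1 ^+ 2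
  + 2 * l2 * ((E 0 1 * E 0 2 - E 0 0 * E 1 2) * l1
                     + (E 0 1 * E 1 2 - E 0 2 * E 1 1) * l0)
  + (E 0 0 * E 1 1 - E 0 1 ^+ 2) * l2 ^+ 2 = 0.
  set dt := E 0 0 * (E 1 1 * E 2 2 - E 1 2 ^+ 2) - E 0 1 * (E 0 1 * E 2 2 - E 0 2 * E 1 2)
     + E 0 2 * (E 0 1 * E 1 2 - E 0 2 * E 1 1).
  transitivity (dt * (l0 * x 0 0 + l1 * x 0 1 + l2 * x 0 2)).
    by rewrite /dt /l0 /l1 /l2; ring.
  by rewrite lx mulr0.
set u0 := (b - a) 0 0; set u1 := (b - a) 0 1.
have lu : l0 * u0 + l1 * u1 = 0.
  rewrite /u0 /u1 !mxE.
  transitivity ((l0 * b 0 0 + l1 * b 0 1 + l2 * 1) - (l0 * a 0 0 + l1 * a 0 1 + l2 * 1)).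
    by ring.
  by rewrite la lb subrr.
have cE : cross a b = a 0 0 * u1 - a 0 1 * u0 by rewrite /cross /u0 /u1 !mxE; ring.
have [t [t0 t1 t2]] : exists t, [/\ l0 = - t * u1, l1 = t * u0 & l2 = t * cross a b].
  have l2E : l2 = - (l0 * a 0 0 + l1 * a 0 1).
    by apply/eqP; rewrite -addr_eq0 addrC -[l2]mulr1 la.
  have [u00|u00] := eqVneq u0 0; last first.
    exists (l1 / u0).
    have e0 : l0 = - (l1 / u0) * u1.
      apply: (mulIf u00); apply/eqP; rewrite -subr_eq0; apply/eqP.
      by rewrite -[RHS]lu; field.
    by split=> //; [field|rewrite l2E cE e0; field].
  have u10 : u1 != 0.
    apply: contra_neq ab => u10; apply/eqP; rewrite eq_sym -subr_eq0; apply/eqP.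
    by apply: row2P; [rewrite -/u0 u00|rewrite -/u1 u10]; rewrite mxE.
  have e1 : l1 = 0 by apply: (mulIf u10); rewrite mul0r -[RHS]lu u00 mulr0 add0r.
  exists (- l0 / u1); split; first by field.
    by rewrite e1 u00 mulr0.
  by rewrite l2E cE e1 u00; field.
have tn0 : t != 0.
  by apply/eqP => tz; apply: l_neq0; rewrite t0 t1 t2 tz; split; ring.
have tt : t ^+ 2 != 0 by rewrite expf_neq0.
apply: (mulfI tt); rewrite mulr0 -[RHS]adj t0 t1 t2; ring.
Qed.

(** Otherwise the quadratic part of [E] has a real isotropic direction, which
    is a point of the conic at infinity. *)
Lemma ellipse_entries E : is_ellipse E -> 0 < E 0 0 * E 1 1 - E 0 1 ^+ 2.
Proof.
move=> [[sE _ _] noinf]; rewrite ltNge; apply/negP => D0.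
have key (d : 'rV[R]_2) : d != 0 ->
    E 0 0 * d 0 0 ^+ 2 + 2 * E 0 1 * d 0 0 * d 0 1 + E 1 1 * d 0 1 ^+ 2 != 0.
  move=> d0; apply/eqP => e; apply: (noinf d d0).
  rewrite /on_conic (mx11_scalar (_ *m _)) form3E.
  have [-> -> ->] := at_infinityE3 d.
  rewrite (sym_entries 1 0 sE) (_ : _ + _ = 0) ?raddf0 // -[RHS]e; ring.
(* A real zero of the binary form, by the quadratic formula. *)
pose r := Num.sqrt (E 0 1 ^+ 2 - E 0 0 * E 1 1).
have r2 : r ^+ 2 = E 0 1 ^+ 2 - E 0 0 * E 1 1.
  by rewrite sqr_sqrtr // -oppr_le0 opprB.
have [e00|e00] := eqVneq (E 0 0) 0.
  have := key (delta_mx 0 0); rewrite !mxE /= e00 => /(_ _)/eqP; apply; last by ring.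
  by apply/eqP => /rowP/(_ 0); rewrite !mxE => /eqP; rewrite oner_eq0.
pose d : 'rV[R]_2 := (- E 0 1 + r) *: delta_mx 0 0 + E 0 0 *: delta_mx 0 1.
have d1 : d 0 1 = E 0 0 by rewrite !mxE /= ; ring.
have d0 : d 0 0 = - E 0 1 + r by rewrite !mxE /= ; ring.
have := key d; rewrite d0 d1 => /(_ _)/eqP; apply; last by ring: r2.
by apply: contra_neq e00 => /rowP/(_ 1); rewrite d1 mxE.
Qed.

(** An edge and the opposite one have the same [side] and opposite directions.
    Comparing the two instances of [line_tangent_dual] kills its mixed terms,
    so [E 0 2 = E 1 2 = 0]: the ellipse is centred at the origin. *)
Lemma ellipse_qform P E : centrally_symmetric P -> is_ellipse E ->
  circumscribed P E -> (forall k, side P k != 0) ->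
  (forall k, cross (P (k + 1) - P k) (P (k + 2) - P (k + 1)) != 0) ->
  exists p q r, 0 < p * r - q ^+ 2 /\ forall k,
    qform p q r (P (k + 1) - P k) (P (k + 1) - P k) = side P k ^+ 2.
Proof.
move=> cs ellE circ a0 uu; have := uu 0; rewrite !add0r => u01.
have [[sE uE _] _] := ellE.
have D0 := ellipse_entries ellE.
have tan k := line_tangent_dual sE uE (circ k).
pose f02 := E 0 1 * E 1 2 - E 0 2 * E 1 1.
pose f12 := E 0 1 * E 0 2 - E 0 0 * E 1 2.
have center k : f12 * (P (k + 1) - P k) 0 0 = f02 * (P (k + 1) - P k) 0 1.
  have h1 := tan k; have h2 := tan (k + 4).
  have crossNN (a b : 'rV[R]_2) : cross (- a) (- b) = cross a b.
    by rewrite crossNl crossNr opprK.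
  rewrite (addrAC k 4 1) !cs crossNN -opprD in h2.
  have neg (w : 'rV[R]_2) j : (- w) 0 j = - w 0 j by rewrite mxE.
  rewrite !neg !sqrrN -/(side P k) in h1 h2.
  apply: (mulIf (a0 k)); rewrite /f02 /f12; move: (_ 0 0) (_ 0 1) h1 h2 => u0 u1 h1 h2.
  by move: h1 h2; lra.
have := center 0; have := center 1.
rewrite add0r (_ : (1 : 'Z_8) + 1 = 2); last exact/val_inj.
move: u01; rewrite [cross (P 1 - P 0) _]/cross.
set w0 := (P 2 - P 1) 0 0; set w1 := (P 2 - P 1) 0 1.
set u0 := (P 1 - P 0) 0 0; set u1 := (P 1 - P 0) 0 1 => uw0 cw cu.
have f02_0 : f02 = 0.
  apply: (mulIf uw0); rewrite mul0r.
  transitivity (u0 * (f02 * w1) - f02 * u1 * w0); first by ring.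
  by rewrite -cw -cu; ring.
have f12_0 : f12 = 0.
  apply: (mulIf uw0); rewrite mul0r.
  transitivity (f12 * u0 * w1 - u1 * (f12 * w0)); first by ring.
  by rewrite cw cu; ring.
have Dn0 : E 0 0 * E 1 1 - E 0 1 ^+ 2 != 0 by rewrite gt_eqF.
have E02 : E 0 2 = 0.
  apply: (mulIf Dn0); rewrite mul0r.
  transitivity (- (E 0 0 * f02 + E 0 1 * f12)); first by rewrite /f02 /f12; ring.
  by rewrite f02_0 f12_0; ring.
have E12 : E 1 2 = 0.
  apply: (mulIf Dn0); rewrite mul0r.
  transitivity (- (E 1 1 * f12 + E 0 1 * f02)); first by rewrite /f02 /f12; ring.
  by rewrite f02_0 f12_0; ring.
have E22 : E 2 2 != 0.
  apply/eqP => e22; have : (delta_mx 0 2 : 'rV[R]_3) *m E = 0.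
    rewrite -rowE; apply/rowP => j; rewrite !mxE.
    have [->|[->|->//]] : j = 0 \/ j = 1 \/ j = 2.
      by case: j => [[|[|[|//]]]] jlt; [left|right; left|right; right]; exact/val_inj.
    - by rewrite (sym_entries 2 0 sE).
    - by rewrite (sym_entries 2 1 sE).
  move=> h; have := mulmxK uE (delta_mx 0 2 : 'rV[R]_3); rewrite h mul0mx.
  by move=> /rowP/(_ 2)/eqP; rewrite !mxE eqxx eq_sym oner_eq0.
set D := _ - _ in D0 Dn0.
pose m := - (E 2 2 / D).
exists (m * E 0 0), (m * E 0 1), (m * E 1 1); split.
  rewrite (_ : _ - _ = m ^+ 2 * D); last by rewrite /D; ring.
  by rewrite mulr_gt0 // exprn_even_gt0 //= oppr_eq0 mulf_neq0 // invr_eq0.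
move=> k; have := tan k; rewrite -/D -/(side P k) E02 E12 /qform.
move: ((P (k + 1) - P k) 0 0) ((P (k + 1) - P k) 0 1) => a b h.
apply: (mulIf Dn0); move: h; rewrite /m; clearbody D => h.
transitivity (- (E 2 2 * (E 0 0 * a * a + 2 * E 0 1 * a * b + E 1 1 * b * b))).
  by field.
by move: h; lra.
Qed.

End Ellipse.

(** * Convexity and coordinates *)

Section ConvexCoordinates.
Variable R : realType.
Implicit Types (P : octagon R) (al be s x y t z : R).

(** The linear relation is z = 0, see [chart_origin]. *)
Definition poncelet_coords al be s x y : Prop :=
  [/\ [/\ 0 < s, 0 < x & 0 < y], al ^+ 2 < 1, be ^+ 2 < 1,
      conic_eq al be s x y & (1 - al ^+ 2) * x = (1 - be ^+ 2) * y].

Lemma poncelet_coords_turn al be s x y :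
  poncelet_coords al be s x y -> poncelet_coords be (- al) s y x.
Proof.
move=> [[s0 x0 y0] al1 be1 Q e]; split; rewrite ?sqrrN //.
by rewrite /conic_eq Q sqrrN; ring.
Qed.

Lemma ltr_of_sqr (c d : R) : 0 < d -> c ^+ 2 < d ^+ 2 -> c < d.
Proof.
move=> d0 h; rewrite ltNge; apply/negP => dc.
have c0 := lt_le_trans d0 dc.
by move: h; rewrite ltNge ler_sqr ?dc // nnegrE ltW.
Qed.

Lemma poncelet_coords_bounds al be s x y : poncelet_coords al be s x y ->
  al * x + be * y < s /\ x + be * y < s.
Proof.
move=> [[s0 x0 y0] al1 be1 Q e].
have albe : al * be < 1.
  have := sqr_ge0 (al - be); rewrite sqrrB; move: al1 be1.
  by rewrite -mulr_natl; move: (al ^+ 2) (be ^+ 2) (al * be) => p q r; lra.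
have be_1 : be < 1 by apply: ltr_of_sqr; rewrite ?expr1n.
split; apply: ltr_of_sqr => //; rewrite -subr_gt0.
- rewrite (_ : _ - _ = 2 * x * y * (1 - al * be)).
    by rewrite !mulr_gt0 // subr_gt0.
  by rewrite Q; ring.
- rewrite (_ : _ - _ = x * (2 * y - 2 * be * y - (1 - al ^+ 2) * x)); last first.
    by rewrite Q; ring.
  rewrite e (_ : _ - _ = y * (1 - be) ^+ 2); last by ring.
  by rewrite !mulr_gt0 ?exprn_gt0 ?subr_gt0.
Qed.

(** By central symmetry the brackets of the vertices with the edge 01 are linear
    in the coordinates; [poncelet_coords_bounds] controls those that
    are not visibly positive. *)
Lemma first_edge P al be s x y : centrally_symmetric P ->
  has_coords P al be s x y -> poncelet_coords al be s x y ->
  forall j, j != 0 -> j != 1 -> 0 < cross (P 1 - P 0) (P j - P 0).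
Proof.
move=> cs [[e0 e1 e2 e3] f0 f1] pc.
have [[s0 x0 y0] al1 be1 Q e] := pc.
have p4 : P 4 = - P 0 by rewrite -(cs 0); congr P; exact/val_inj.
have p5 : P 5 = - P 1 by rewrite -(cs 1); congr P; exact/val_inj.
have p6 : P 6 = - P 2 by rewrite -(cs 2); congr P; exact/val_inj.
have p7 : P 7 = - P 3 by rewrite -(cs 3); congr P; exact/val_inj.
have e3' : cross (P 0) (P 3) = s + al * x - be * y.
  by rewrite -e3 p4 crossNr -crossC.
have pcN : poncelet_coords (- al) (- be) s x y.
  by split; rewrite ?sqrrN //; rewrite /conic_eq !sqrrN.
have [b1 b2] := poncelet_coords_bounds pc.
have [b3 b4] := poncelet_coords_bounds pcN.
have al_1 : al < 1 by apply: ltr_of_sqr; rewrite ?expr1n.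
have be_1 : be < 1 by apply: ltr_of_sqr; rewrite ?expr1n.
have al_N1 : - al < 1 by apply: ltr_of_sqr; rewrite ?expr1n ?sqrrN.
have be_N1 : - be < 1 by apply: ltr_of_sqr; rewrite ?expr1n ?sqrrN.
have ax : 0 < (1 + al) * x by rewrite mulr_gt0 // -(opprK al) subr_gt0.
have ay : 0 < (1 + be) * y by rewrite mulr_gt0 // -(opprK be) subr_gt0.
have ay' : 0 < (1 - be) * y by rewrite mulr_gt0 // subr_gt0.
have a0 : 0 < s + al * x + be * y by move: b3; lra.
apply: Z8_ind => //.
- have -> : cross (P 1 - P 0) (P 2 - P 0) =
    cross (P 0) (P 1) + cross (P 1) (P 2) - cross (P 0) (P 2).
    by rewrite /cross !mxE; ring.
  by rewrite e0 e1 f0; move: b4; lra.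
- have -> : cross (P 1 - P 0) (P 3 - P 0) =
    cross (P 0) (P 1) + cross (P 1) (P 3) - cross (P 0) (P 3).
    by rewrite /cross !mxE; ring.
  by rewrite e0 e3' f1; move: ay; lra.
- rewrite p4 (_ : cross _ _ = 2 * cross (P 0) (P 1)); last by rewrite /cross !mxE; ring.
  by rewrite e0; move: a0; lra.
- rewrite p5 (_ : cross _ _ = 2 * cross (P 0) (P 1)); last by rewrite /cross !mxE; ring.
  by rewrite e0; move: a0; lra.
- rewrite p6 (_ : cross _ _ =
    cross (P 0) (P 1) + cross (P 0) (P 2) - cross (P 1) (P 2)); last first.
    by rewrite /cross !mxE; ring.
  by rewrite e0 e1 f0; move: ax; lra.
- rewrite p7 (_ : cross _ _ =
    cross (P 0) (P 1) + cross (P 0) (P 3) - cross (P 1) (P 3)); last first.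
    by rewrite /cross !mxE; ring.
  rewrite e0 e3' f1.
  have [_ h] := poncelet_coords_bounds (poncelet_coords_turn pc).
  by move: h; lra.
Qed.

Lemma poncelet_coords_convex P al be s x y : centrally_symmetric P ->
  has_coords P al be s x y -> poncelet_coords al be s x y -> convex P.
Proof.
move=> cs hc pc; left.
have h n : forall P al be s x y, centrally_symmetric P ->
    has_coords P al be s x y -> poncelet_coords al be s x y ->
    forall j, j != n%:R -> j != n%:R + 1 ->
      0 < cross (P (n%:R + 1) - P n%:R) (P j - P n%:R).
  elim: n => [|n IH] {cs hc pc} {}P {}al {}be {}s {}x {}y cs hc pc j j0 j1.
    by rewrite add0r; apply: (first_edge cs hc pc) => //; rewrite -(add0r 1).
  have := IH _ _ _ _ _ _ (cs_turn cs) (turn_coords cs hc) (poncelet_coords_turn pc) (j - 1).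
  rewrite /turn subrK -natr1; apply.
  - by rewrite subr_eq natr1.
  - by rewrite subr_eq natr1.
move=> i j; have := h (val i) P al be s x y cs hc pc j.
by rewrite Zp_nat; rewrite (_ : inZp i = i) //; apply/val_inj => /=; rewrite modn_small.
Qed.

End ConvexCoordinates.

(** * Convex circumscribed octagons in the chart *)

Section ChartOctagons.
Variable R : realType.
Implicit Types (P : octagon R) (al be s x y t z : R).

Lemma normal_octagon_scale al be t s x y : t != 0 ->
  normal_octagon al be (t * s) (t * x) (t * y) = normal_octagon al be s x y.
Proof.
move=> t0; have ratio (c : R) : t * c / (2 * (t * x)) = c / (2 * x).
  by rewrite [2 * _]mulrCA -mulf_div divff // mul1r.
have e1 : t * s - al * (t * x) + be * (t * y) = t * (s - al * x + be * y) by ring.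
have e0 : t * s + al * (t * x) + be * (t * y) = t * (s + al * x + be * y) by ring.
have e2 : - (t * s - al * (t * x) - be * (t * y)) =
  t * (- (s - al * x - be * y)) by ring.
have e3 : t * s + al * (t * x) - be * (t * y) = t * (s + al * x - be * y) by ring.
by apply/funext => i; rewrite /normal_octagon e0 e1 e2 e3 !ratio.
Qed.

Lemma chart_octagonE P al be t z : centrally_symmetric P -> t != 0 ->
  chart_x al be z != 0 -> in_chart al be P t z ->
  forall i, P i *m frame (P 0) (P 2) = chart_octagon al be z i.
Proof.
move=> cs t0 x0 hc i; rewrite (cs_normalise cs _ hc) ?mulf_neq0 //.
by rewrite normal_octagon_scale.
Qed.

(** Convexity at the vertices i + 3 and i + 6, as seen from edge i, gives
    |a_k - a_(k+1)| < |b_k|, hence |al|, |be| < 1.  The sign [eps] is the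
    orientation of the octagon. *)
Lemma convex_in_chart P (E : 'M[R]_3) : convex P -> centrally_symmetric P ->
  is_ellipse E -> circumscribed P E ->
  exists al be t z, [/\ al ^+ 2 < 1, be ^+ 2 < 1, t != 0, chart_pos al be z
                      & in_chart al be P t z].
Proof.
move=> cvx cs ellE circ.
have [eps [eps2 left]] : exists eps : R, eps ^+ 2 = 1 /\ forall i j, j != i ->
    j != i + 1 -> 0 < eps * cross (P (i + 1) - P i) (P j - P i).
  case: cvx => h; [exists 1|exists (-1)]; split.
  - by rewrite expr1n.
  - by move=> i j ji ji1; rewrite mul1r; exact: h.
  - by rewrite sqrrN expr1n.
  - by move=> i j ji ji1; rewrite mulN1r oppr_gt0; exact: h.
have shift_neq (i d : 'Z_8) : d != 0 -> d != 1 -> i + d != i /\ i + d != i + 1.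
  move=> d0 d1; rewrite (inj_eq (addrI i)); split=> //.
  by rewrite -subr_eq0 addrAC subrr add0r.
have side_gt0 i : 0 < eps * side P i.
  have [n0 n1] := shift_neq i 4 isT isT.
  have := left _ _ n0 n1; rewrite cs.
  rewrite (_ : cross _ _ = 2 * side P i); last by rewrite /side /cross !mxE; ring.
  by move: (side P i) => c; lra.
have side_neq0 i : side P i != 0.
  by apply: contraTneq (side_gt0 i) => ->; rewrite mulr0 ltxx.
have turn_neq0 i : cross (P (i + 1) - P i) (P (i + 2) - P (i + 1)) != 0.
  have [n0 n1] := shift_neq i 2 isT isT.
  have := left _ _ n0 n1.
  rewrite (_ : cross _ (_ - P i) = cross (P (i + 1) - P i) (P (i + 2) - P (i + 1))).
    by apply: contraTneq => ->; rewrite mulr0 ltxx.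
  by rewrite /cross !mxE; ring.
have [p [q [r [d0 pqr]]]] := ellipse_qform cs ellE circ side_neq0 turn_neq0.
have pit := pitot cs d0 side_neq0 turn_neq0 pqr.
have h6 i : 0 < eps * (side P i + chord P i - side P (i + 1)).
  have [n0 n1] := shift_neq i 6 isT isT; have := left _ _ n0 n1.
  rewrite (_ : i + 6 = i + 2 + 4) ?cs; last by ring.
  rewrite (_ : cross _ _ = side P i + chord P i - side P (i + 1)) //.
  rewrite /side /chord (_ : i + 1 + 1 = i + 2); last by ring.
  by rewrite /cross !mxE; ring.
have h3 i : 0 < eps * (side P i + chord P (i + 1) - side P (i + 3)).
  have [n0 n1] := shift_neq i 3 isT isT; have := left _ _ n0 n1.
  rewrite (_ : cross _ _ = side P i + chord P (i + 1) - side P (i + 3)) //.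
  rewrite /side /chord (_ : i + 1 + 2 = i + 3); last by ring.
  rewrite (_ : i + 3 + 1 = i + 4) ?cs; last by ring.
  by rewrite /cross !mxE; ring.
have s40 : side P 4 = side P 0 by rewrite -(side_add4 cs 0) add0r.
have c20 : chord P 2 = chord P 0 by rewrite -(chord_add2 cs 0) add0r.
have c31 : chord P 3 = chord P 1.
  by rewrite -(chord_add2 cs 1); congr chord; exact/val_inj.
have X0 := h6 0; have X1 := h3 1; have Y0 := h3 0; have Y1 := h6 3.
rewrite add0r in X0; rewrite !add0r in Y0.
rewrite (_ : (1 : 'Z_8) + 1 = 2) ?c20 in X1; last exact/val_inj.
rewrite (_ : (1 : 'Z_8) + 3 = 4) ?s40 in X1; last exact/val_inj.
rewrite (_ : (3 : 'Z_8) + 1 = 4) ?s40 ?c31 in Y1; last exact/val_inj.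
have S0 := side_gt0 0; have S2 := side_gt0 2.
pose x := chord P 0 / 2; pose y := chord P 1 / 2.
pose s := (side P 0 + side P 2) / 2.
pose al := (side P 0 - side P 1) / chord P 0.
pose be := (side P 0 - side P 3) / chord P 1.
have epsM (c : R) : eps * (eps * c) = c by rewrite mulrA -expr2 eps2 mul1r.
have c0 : 0 < eps * chord P 0 by move: X0 X1; rewrite !(mulrDr, mulrN); lra.
have c1 : 0 < eps * chord P 1 by move: Y0 Y1; rewrite !(mulrDr, mulrN); lra.
have c00 : chord P 0 != 0 by apply: contraTneq c0 => ->; rewrite mulr0 ltxx.
have c10 : chord P 1 != 0 by apply: contraTneq c1 => ->; rewrite mulr0 ltxx.
have square_lt1 (d c : R) : 0 < eps * (c + d) -> 0 < eps * (c - d) -> c != 0 ->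
    (d / c) ^+ 2 < 1.
  move=> h1 h2 cn0; rewrite expr_div_n ltr_pdivrMr ?exprn_even_gt0 // mul1r.
  rewrite -subr_gt0 (_ : _ - _ = eps * (c + d) * (eps * (c - d))).
    exact: mulr_gt0.
  transitivity (eps ^+ 2 * ((c + d) * (c - d))); last by ring.
  by rewrite eps2; ring.
have al1 : al ^+ 2 < 1.
  by apply: square_lt1 => //; [move: X0|move: X1]; rewrite !(mulrDr, mulrN); lra.
have be1 : be ^+ 2 < 1.
  by apply: square_lt1 => //; [move: Y0|move: Y1]; rewrite !(mulrDr, mulrN); lra.
have alx : al * x = (side P 0 - side P 1) / 2 by rewrite /al /x; field.
have bey : be * y = (side P 0 - side P 3) / 2 by rewrite /be /y; field.
have hc : has_coords P al be s x y.
  have side3 : cross (P 3) (P 4) = side P 3.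
    by rewrite /side; congr (cross _ (P _)); exact/val_inj.
  have side1 : cross (P 1) (P 2) = side P 1.
    by rewrite /side; congr (cross _ (P _)); exact/val_inj.
  have side2 : cross (P 2) (P 3) = side P 2.
    by rewrite /side; congr (cross _ (P _)); exact/val_inj.
  have side0 : cross (P 0) (P 1) = side P 0 by rewrite /side add0r.
  have chord0 : cross (P 0) (P 2) = chord P 0 by rewrite /chord add0r.
  have chord1 : cross (P 1) (P 3) = chord P 1.
    by rewrite /chord; congr (cross _ (P _)); exact/val_inj.
  rewrite /has_coords side0 side1 side2 side3 chord0 chord1 alx bey /s /x /y.
  by split; [split|field|field]; move: pit; lra.
have Q := coords_conic cs hc.
have s0 : 0 < eps * s by rewrite /s; move: S0 S2; lra.
have x0 : 0 < eps * x by rewrite /x; move: c0; lra.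
have y0 : 0 < eps * y by rewrite /y; move: c1; lra.
have u0 := rootU_gt0 al1 be1; have v0 := rootV_gt0 al1 be1.
pose w := rootV al be * (x + y) + rootU al be * s.
have w0 : 0 < eps * w.
  rewrite (_ : eps * w = rootV al be * (eps * x + eps * y) + rootU al be * (eps * s)).
    by apply: addr_gt0; apply: mulr_gt0 => //; exact: addr_gt0.
  by rewrite /w; ring.
have wn0 : w != 0 by apply: contraTneq w0 => ->; rewrite mulr0 ltxx.
have [z [sE xE yE]] := chart_surj al1 be1 Q wn0.
set t := _ / _ in sE xE yE.
have t0 : 0 < eps * t.
  by rewrite /t mulrA divr_gt0 // !mulr_gt0 ?exprn_gt0.
exists al, be, t, z; split=> //.
- by apply: contraTneq t0 => ->; rewrite mulr0 ltxx.
- rewrite sE mulrA in s0; rewrite xE mulrA in x0; rewrite yE mulrA in y0.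
  by split; [rewrite -(pmulr_rgt0 _ t0)|rewrite -(pmulr_rgt0 _ t0)|rewrite -(pmulr_rgt0 _ t0)].
- by rewrite /in_chart -sE -xE -yE.
Qed.

Lemma chart_origin al be (al1 : al ^+ 2 < 1) (be1 : be ^+ 2 < 1) :
  poncelet_coords al be (chart_s al be 0) (chart_x al be 0) (chart_y al be 0).
Proof.
have Q := chart_conic al1 be1 0.
have sE : chart_s al be 0 = rootU al be * rootV al be by rewrite /chart_s; ring.
have xE : chart_x al be 0 = 1 - be ^+ 2 by rewrite /chart_x; ring.
have yE : chart_y al be 0 = 1 - al ^+ 2 by rewrite /chart_y; ring.
rewrite sE xE yE in Q *; split=> //; last by ring.
by rewrite !subr_gt0 mulr_gt0 // ?rootU_gt0 ?rootV_gt0.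
Qed.

Lemma in_chart_octagon al be z : al ^+ 2 < 1 -> be ^+ 2 < 1 -> chart_x al be z != 0 ->
  in_chart al be (chart_octagon al be z) (2 * chart_x al be z)^-1 z.
Proof. by move=> al1 be1 x0; apply: normal_octagon_coords => //; exact: chart_conic. Qed.

End ChartOctagons.

(** * The limit octagon *)

Section Limits.
Variables (R : realType) (al be : R).
Hypotheses (al1 : al ^+ 2 < 1) (be1 : be ^+ 2 < 1).
Implicit Types (P : octagon R) (t z : R).

Let A0 : 1 - al ^+ 2 != 0.
Proof. by rewrite subr_eq0 gt_eqF. Qed.

Let B0 : 1 - be ^+ 2 != 0.
Proof. by rewrite subr_eq0 gt_eqF. Qed.

Lemma chart_origin_inscribed :
  exists2 C, is_conic C & inscribed (chart_octagon al be 0) C.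
Proof.
have [[s0 x0 y0] _ _ Q e] := chart_origin al1 be1.
by apply: normal_inscribed => //; rewrite gt_eqF // rootV_arg.
Qed.

(** This is how the hypothesis that the octagon is not Poncelet enters: it
    excludes z = 0, the fixed point of [T3] that is repelling for the
    inverse. *)
Lemma in_chart0_Poncelet P t (E : 'M[R]_3) : centrally_symmetric P -> t != 0 ->
  in_chart al be P t 0 -> is_conic E -> circumscribed P E -> Poncelet P.
Proof.
move=> cs t0 hc cE circ; have [C cC iC] := chart_origin_inscribed.
have [[s0 x0 y0] _ _ Q e] := chart_origin al1 be1.
have xn0 : chart_x al be 0 != 0 by rewrite gt_eqF.
have uF : frame (P 0) (P 2) \in unitmx.
  by apply: frame_unit; case: hc => _ -> _; rewrite !mulf_neq0 // pnatr_eq0.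
apply: (inscribed_circumscribed_Poncelet (is_conic_pullback uF cC) cE _ circ).
apply: inscribed_pullback => k.
by rewrite (chart_octagonE cs t0 xn0 hc); exact: iC.
Qed.

Local Notation Q := (chart_octagon al be 0).

Lemma limit_cs : centrally_symmetric Q.
Proof. exact: normal_octagon_cs. Qed.

Lemma limit_convex : convex Q.
Proof.
have pc := chart_origin al1 be1; have [[s0 x0 y0] _ _ qc e] := pc.
have x0' : chart_x al be 0 != 0 by rewrite gt_eqF.
have t0 : 0 < (2 * chart_x al be 0)^-1 by rewrite invr_gt0 mulr_gt0.
apply: (poncelet_coords_convex limit_cs (in_chart_octagon al1 be1 x0')).
split=> //; first by split; apply: mulr_gt0.
  by move: qc; rewrite /conic_eq !exprMn => ->; ring.
by rewrite mulrCA e [RHS]mulrCA.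
Qed.

Lemma chart_origin_xys :
  chart_s al be 0 < chart_x al be 0 + chart_y al be 0.
Proof.
have -> : chart_x al be 0 + chart_y al be 0 = rootU al be ^+ 2.
  by rewrite rootU2 // /chart_x /chart_y; ring.
rewrite /chart_s expr0n subr0 mulr1 expr2 ltr_pM2l ?rootU_gt0 //.
exact: rootV_lt_rootU.
Qed.

Lemma limit_Poncelet : Poncelet Q.
Proof.
have [[s0 x0 y0] _ _ qc e] := chart_origin al1 be1.
have V0 : 1 - al ^+ 2 * be ^+ 2 != 0 by rewrite gt_eqF // rootV_arg.
have [C cC iC] := chart_origin_inscribed.
have [D cD circ] : exists2 D, is_conic D & circumscribed Q D.
  apply: normal_circumscribed => //; rewrite ?(gt_eqF x0) ?(gt_eqF y0) //.
  by rewrite gt_eqF // chart_origin_xys.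
exact: inscribed_circumscribed_Poncelet iC circ.
Qed.

Lemma star_cs P : centrally_symmetric P -> centrally_symmetric (star P).
Proof.
move=> cs k; rewrite /star -cs; congr P; rewrite mulrDr; congr (_ + _).
exact/val_inj.
Qed.

Lemma star_coords P s x y : centrally_symmetric P -> has_coords P al be s x y ->
  has_coords (star P) (- al) be s (- x) (- y).
Proof.
move=> cs [[e0 e1 e2 e3] f0 f1].
have p4 : P 4 = - P 0 by rewrite -(cs 0); congr P; exact/val_inj.
have t0 : star P 0 = P 0 by congr P; exact/val_inj.
have t1 : star P 1 = P 3 by congr P; exact/val_inj.
have t2 : star P 2 = - P 2 by rewrite -cs; congr P; exact/val_inj.
have t3 : star P 3 = P 1 by congr P; exact/val_inj.
have t4 : star P 4 = - P 0 by rewrite -cs; congr P; exact/val_inj.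
have n03 : cross (P 0) (P 3) = s + al * x - be * y.
  by rewrite -e3 p4 crossNr -crossC.
rewrite /has_coords t0 t1 t2 t3 t4 !crossNr !crossNl n03 f0.
rewrite -(crossC (P 2) (P 3)) e2 -(crossC (P 1) (P 2)) e1 -(crossC (P 0) (P 1)) e0.
by rewrite (crossC (P 3)) f1; split; [split|..]; ring.
Qed.

(** The conic through the vertices is the same as for the octagon itself.  The
    tangent one comes from [normal_circumscribed], whose condition
    x + y != s survives the change of sign of x and y. *)
Lemma star_limit_Poncelet : Poncelet (star Q).
Proof.
have [[s0 x0 y0] _ _ qc e] := chart_origin al1 be1.
have x0' : chart_x al be 0 != 0 by rewrite gt_eqF.
have hc := in_chart_octagon al1 be1 x0'.
have [C cC iC] := chart_origin_inscribed.
have hs := star_coords limit_cs hc.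
set t := (2 * chart_x al be 0)^-1 in hs.
have t0 : 0 < t by rewrite /t invr_gt0 mulr_gt0.
set s := t * _ in hs; set x := t * _ in hs; set y := t * chart_y _ _ _ in hs.
have xn0 : - x != 0 by rewrite oppr_eq0 mulf_neq0 ?gt_eqF.
have yn0 : - y != 0 by rewrite oppr_eq0 mulf_neq0 ?gt_eqF.
have uF : frame (star Q 0) (star Q 2) \in unitmx.
  by apply: frame_unit; case: hs => _ -> _; rewrite mulf_neq0 // pnatr_eq0.
have [D cD circ] : exists2 D, is_conic D &
    circumscribed (normal_octagon (- al) be s (- x) (- y)) D.
  apply: normal_circumscribed; rewrite ?sqrrN //.
  - exact: coords_conic (star_cs limit_cs) hs.
  - by rewrite gt_eqF // rootV_arg.
  - have [sp xp yp] : [/\ 0 < s, 0 < x & 0 < y] by split; apply: mulr_gt0.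
    by rewrite lt_eqF //; move: sp xp yp; clearbody s x y; lra.
apply: (inscribed_circumscribed_Poncelet cC (is_conic_pullback uF cD)).
  by move=> k; exact: iC.
apply: circumscribed_pullback => // k.
by rewrite !(cs_normalise (star_cs limit_cs) xn0 hs); exact: circ.
Qed.

(** The frames of the shifted iterates bring them to the normal form, which
    depends continuously on z. *)
Lemma orbit_cvg P t z : centrally_symmetric P -> t != 0 -> in_chart al be P t z ->
  (forall k, T3_defined (iter k (@T3 R) P)) ->
  exists2 M : nat -> 'M[R]_2, forall k, M k \in unitmx &
    forall i, (fun k => iter k (@T3 R) P (i + k%:R) *m M k) @ \oo --> Q i.
Proof.
move=> cs t0 hc hd.
pose Y k := turn_by k%:R (iter k (@T3 R) P).
have csY k : centrally_symmetric (Y k).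
  by rewrite /Y; apply: cs_turn_by; elim: k => //= m; exact: cs_T3.
have step k : exists2 tk, tk != 0 & in_chart al be (Y k) tk ((- rate al be) ^+ k * z).
  exact: (iter_T3_in_chart al1 be1 cs t0 hc (fun i _ => hd i)).
have x0 k : chart_x al be ((- rate al be) ^+ k * z) != 0.
  have [tk tk0 hk] := step k.
  have dk : T3_defined (Y k) by apply/T3_defined_turn_by.
  have [] := (conic_factors_neq0 (coords_conic (csY k) hk)).1
    ((T3_defined_coords (csY k) hk).1 dk).
  by rewrite !mulf_eq0 !negb_or => /andP[/andP[]].
exists (fun k => frame (Y k 0) (Y k 2)).
  move=> k; have [tk tk0 [_ e _]] := step k.
  by apply: frame_unit; rewrite e !mulf_neq0 // pnatr_eq0.
move=> i.
rewrite (_ : (fun k => _) = fun k => chart_octagon al be ((- rate al be) ^+ k * z) i).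
  apply: chart_octagon_cvg => //.
  rewrite -(mul0r z); apply: cvgM; last exact: cvg_cst.
  by apply: cvg_expr; rewrite normrN ger0_norm ?rate_ge0 ?rate_lt1.
apply/funext => k; have [tk tk0 hk] := step k.
exact: (chart_octagonE (csY k) tk0 (x0 k) hk).
Qed.

End Limits.

(** * The inverse map as the 3-diagonal map of a reordered octagon *)

Section Backward.
Variable R : realType.
Implicit Types P : octagon R.

Lemma meet_swap (a b c d : 'rV[R]_2) : meet_defined a b c d ->
  meet b a d c = meet a b c d.
Proof.
rewrite /meet_defined /meet /cross !mxE => h.
by apply: row2P; rewrite !mxE; field.
Qed.

(** The star-reordering k -> 3k composed with the reversal k -> - k, followed
    by a shift.  The reversal and the shift by [c = 2] are what makes it preserve
    [al] and [be], see [skew_coords]. *)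
Definition skew (c : 'Z_8) P : octagon R := fun k => P (5 * k + c).

(** Multiplication by 5 exchanges the label differences 1 and 3 up to sign, so it
    turns the 3-diagonals met by [T3] into the edges met by [T3inv]. *)
Lemma T3_skew c P : T3inv_defined P ->
  T3_defined (skew c P) /\ T3 (skew c P) = skew (c + 6) (T3inv P).
Proof.
move=> h.
have corner k : let j := 5 * k + (c + 6) in
  [/\ skew c P (k + 1) = P (j - 1), skew c P (k + 4) = P (j - 2),
      skew c P (k + 2) = P (j - 4) & skew c P (k + 5) = P (j - 5)].
  have e (m n : 'Z_8) : 5 * m = 6 - n ->
      skew c P (k + m) = P (5 * k + (c + 6) - n).
    by rewrite /skew mulrDr => ->; congr P; ring.
  by split; apply: e; exact/val_inj.
have swap (a b d e : 'rV[R]_2) : meet_defined a b d e -> meet_defined b a e d.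
  by rewrite /meet_defined -!(opprB a) -!(opprB d) crossNl crossNr opprK.
split=> [k|].
  by have [-> -> -> ->] := corner k; apply: swap; exact: h.
apply/funext => k; rewrite /T3; have [-> -> -> ->] := corner k.
by rewrite meet_swap //; exact: h.
Qed.

Lemma iter_T3_skew c P n : (forall k, T3inv_defined (iter k (@T3inv R) P)) ->
  iter n (@T3 R) (skew c P) = skew (c + 6 * n%:R) (iter n (@T3inv R) P).
Proof.
move=> h; elim: n => [|n IH]; first by rewrite mulr0 addr0.
rewrite !iterS IH; have [_ ->] := T3_skew (c + 6 * n%:R) (h n).
by rewrite -[n.+1%:R]natr1 (_ : c + 6 * n%:R + 6 = c + 6 * (n%:R + 1)); [|ring].
Qed.

Lemma skew_cs c P : centrally_symmetric P -> centrally_symmetric (skew c P).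
Proof.
move=> cs k; rewrite /skew -cs; congr P.
by rewrite mulrDr addrAC; congr (_ + _); exact/val_inj.
Qed.

(** The reordering changes the sign of all the sides and of no chord, and the
    shift by 2 restores the signs of [al] and [be]. *)
Lemma skew_coords al be P s x y : centrally_symmetric P ->
  has_coords P al be s x y -> has_coords (skew 2 P) al be (- s) x y.
Proof.
move=> cs [[e0 e1 e2 e3] f0 f1].
have p4 : P 4 = - P 0 by rewrite -(cs 0); congr P; exact/val_inj.
have t0 : skew 2 P 0 = P 2 by congr P; exact/val_inj.
have t1 : skew 2 P 1 = - P 3 by rewrite -cs; congr P; exact/val_inj.
have t2 : skew 2 P 2 = - P 0 by rewrite -cs; congr P; exact/val_inj.
have t3 : skew 2 P 3 = P 1 by congr P; exact/val_inj.
have t4 : skew 2 P 4 = - P 2 by rewrite -cs; congr P; exact/val_inj.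
rewrite /has_coords t0 t1 t2 t3 t4 !crossNr !crossNl opprK.
rewrite e2 (crossC (P 3) (P 0)) (crossC (P 2) (P 0)) f0 e1.
have n03 : cross (P 0) (P 3) = s + al * x - be * y.
  by rewrite -e3 p4 crossNr -crossC.
rewrite n03 e0 (crossC (P 3) (P 1)) f1.
by split; [split|..]; ring.
Qed.

(** The point (- s, x, y) of the conic at z is, up to scale, the point at 1/z:
    the sign change exchanges the two fixed points of [T3]. *)
Lemma skew_chart al be P t z : centrally_symmetric P -> z != 0 ->
  in_chart al be P t z -> in_chart al be (skew 2 P) (t * z ^+ 2) z^-1.
Proof.
move=> cs z0 hc; have := skew_coords cs hc.
rewrite /in_chart /chart_s /chart_x /chart_y.
rewrite (_ : t * z ^+ 2 * (_ * (1 - z^-1 ^+ 2)) = - (t * chart_s al be z)); last first.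
  by rewrite /chart_s; field.
rewrite (_ : t * z ^+ 2 * (_ + 2 * _ * z^-1) = t * chart_x al be z); last first.
  by rewrite /chart_x; field.
rewrite (_ : t * z ^+ 2 * (_ - 2 * _ * z^-1) = t * chart_y al be z) //.
by rewrite /chart_y; field.
Qed.

End Backward.

Theorem theorem1p3 (R : realType) (P0 : octagon R) :
  convex P0 -> centrally_symmetric P0 -> ~ Poncelet P0 ->
  (exists E : 'M[R]_3, is_ellipse E /\ circumscribed P0 E) ->
  (forall k : nat, T3_defined (iter k (@T3 R) P0)) /\
  exists Qplus : octagon R,
    [/\ convex Qplus, centrally_symmetric Qplus, Poncelet Qplus
      & octagon_cvg (fun k => iter k (@T3 R) P0) Qplus] /\
    ((forall k : nat, T3inv_defined (iter k (@T3inv R) P0)) ->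
     exists Qminus : octagon R,
       [/\ star_convex Qminus, centrally_symmetric Qminus, Poncelet Qminus
         & octagon_cvg (fun k => iter k (@T3inv R) P0) Qminus] /\
       star_related Qplus Qminus).
Proof.
move=> cvx cs notP [E [ellE circ]].
have [al [be [t [z [al1 be1 t0 zpos hc]]]]] := convex_in_chart cvx cs ellE circ.
have z0 : z != 0.
  apply: contra_notN notP => /eqP z0; rewrite z0 in hc.
  by apply: in_chart0_Poncelet hc _ circ => //; case: ellE.
have defd := iter_T3_defined al1 be1 cs t0 hc zpos.
split=> //; exists (chart_octagon al be 0); split.
  split; [exact: limit_convex|exact: limit_cs|exact: limit_Poncelet|].
  have [M uM cvgM] := orbit_cvg al1 be1 cs t0 hc defd.
  exists M, (fun=> 0), (fun k i => k%:R + i); split=> // [k|i].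
    by exists k%:R; left.
  rewrite /affine_map; under eq_fun do rewrite addr0 addrC; exact: cvgM.
move=> dinv; exists (star (chart_octagon al be 0)).
have starK Q : star (star Q) = Q :> octagon R.
  apply/funext => i; rewrite /star mulrA; congr Q.
  by rewrite (_ : (3 : 'Z_8) * 3 = 1) ?mul1r //; exact/val_inj.
split; last first.
  have id1 p : affine_map (1%:M : 'M[R]_2) 0 p = p by rewrite /affine_map mulmx1 addr0.
  exists 1%:M, 0; split; first exact: unitmx1.
    apply/seteqP; split=> _ [i _ <-]; rewrite ?id1; first by exists (3 * i).
    by exists (3 * i) => //; rewrite id1 -[in RHS](starK (chart_octagon al be 0)).
  exists id; first by exists 0; left => i; rewrite add0r.
  by move=> i; rewrite id1.
split.
- by rewrite /star_convex starK; exact: limit_convex.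
- exact/star_cs/limit_cs.
- exact: star_limit_Poncelet.
have hs := skew_chart cs z0 hc.
have ts0 : t * z ^+ 2 != 0 by rewrite mulf_neq0 // expf_neq0.
have ds k : T3_defined (iter k (@T3 R) (skew 2 P0)).
  by rewrite iter_T3_skew //; case: (T3_skew (2 + 6 * k%:R) (dinv k)).
have [M uM cvgM] := orbit_cvg al1 be1 (skew_cs 2 cs) ts0 hs ds.
exists M, (fun=> 0), (fun k i => 2 + 11 * k%:R - i); split=> // [k|i].
  by exists (2 + 11 * k%:R); right.
rewrite /affine_map /star; under eq_fun do rewrite addr0.
have := cvgM (3 * i); under eq_fun do rewrite iter_T3_skew // /skew.
(* The shift by k from [orbit_cvg], the factor 5 of [skew], its constant
   2 + 6 k after k steps and the factor 3 of [star] add up to a reflection. *)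
have idx (k : nat) : 5 * (3 * i + k%:R) + (2 + 6 * k%:R) = 2 + 11 * k%:R - i :> 'Z_8.
  have -> : - i = 15 * i by rewrite -mulN1r; congr (_ * _); exact/val_inj.
  by ring.
by under eq_fun do rewrite idx.
Qed.
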